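(* Let $Z=\mathbb R^{2N}$ and $\mu=L\,\mathcal L^{2N}\times\mathcal L^{2N}\in\mathcal M(Z\times Z)$ with $L\in L^1_{\rm loc}(Z\times Z)$ non-negative, and assume: (a) there is $\hat L:Z\to\mathbb R$ such that $\hat L(\xi/\sqrt2)=\lim_{\lambda\to+\infty}L(S_\lambda(\xi,\eta))$ for $\mathcal L^{4N}$-a.e. $(\xi,\eta)\in Z\times Z$; (b) there are $g_0\in L^1(Z\times Z)$, $\lambda_0>0$, $\beta_0>0$ such that $\bar w_{\beta_0}(\eta)L(S_\lambda(\xi,\eta))\le g_0(\xi,\eta)$ for $\mathcal L^{4N}$-a.e. $(\xi,\eta)$ and all $\lambda\ge\lambda_0$; (c) the function $\hat g(\xi):=\sup_{\eta\in Z}L\big(\frac{\xi+\eta}{\sqrt2},\frac{\xi-\eta}{\sqrt2}\big)$ belongs to $L^1(Z)$; (d) the diagonal concentration $\mu_\infty$ of $\mu$, i.e. $\mu_\infty(f)=\int_Z f(\xi,\xi)\hat L(\xi)\,d\xi$ for $f\in C_b(Z\times Z)$, satisfies $0<|\mu_\infty|<\infty$. For every $h\in\mathbb N$ let $(A_{h,i})_{i\in\mathbb N}$ be a partition of $Z\times Z$ into Borel sets, let $(y_{h,i},z_{h,i})\in A_{h,i}$, let $c_{h,i}:=\int_{A_{h,i}}L(y,z)\,dy\,dz$ and assume $c_{h,i}<\infty$. Let $\mu_h:=\sum_{i=1}^\infty c_{h,i}\,\delta_{(y_{h,i},z_{h,i})}$, and for $(y,z)\in Z\times Z$ let $\delta_h(y,z)$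 be the diameter of the cell $A_{h,i}$ containing $(y,z)$. Let $(\beta_h)$ be positive numbers with $\beta_h\to+\infty$, let $\lambda_h:=\sqrt{\beta_h/\beta_0}$, and assume $$\lim_{h\to\infty}\lambda_h\sup_{(y,z)\in Z\times Z}\delta_h(y,z)=0.$$ Then, for every $f\in C_b(Z\times Z)$, the approximate expectations $$\mathbb E_{h,\beta_h}[f]:=\frac{\mu_{h,\beta_h}(f)}{|\mu_{h,\beta_h}|}=\frac{\sum_{i=1}^\infty f(y_{h,i},z_{h,i})\,c_{h,i}\,B_{\beta_h}^{-1}e^{-\beta_h\|y_{h,i}-z_{h,i}\|^2}}{\sum_{i=1}^\infty c_{h,i}\,B_{\beta_h}^{-1}e^{-\beta_h\|y_{h,i}-z_{h,i}\|^2}}$$ (defined for all sufficiently large $h$) satisfy $$\lim_{h\to\infty}\mathbb E_{h,\beta_h}[f]=\mathbb E_\infty[f]:=\frac{\mu_\infty(f)}{|\mu_\infty|}.$$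
   Context: $N\ge1$ is an integer; $Z=\mathbb R^{2N}$ is endowed with a scalar product, with corresponding norm $\|\cdot\|$; diameters in $Z\times Z$ are with respect to the norm $\sqrt{\|y\|^2+\|z\|^2}$. For a metric space $X$, $\mathcal M(X)$ is the set of (positive) Radon measures on $X$; $\mu(f):=\int_X f\,d\mu$ and $|\mu|:=\mu(X)\in[0,\infty]$; $C_b(X)$ is the set of bounded continuous real functions on $X$. $L$ is regarded as a fixed, pointwise defined function. For a measure $\nu$ on $Z\times Z$ and $\beta>0$, the thermalized measure is $$\nu_\beta:=w_\beta\,\nu,\quad w_\beta(y,z):=B_\beta^{-1}e^{-\beta\|y-z\|^2},\quad B_\beta:=\int_Z e^{-\beta\|\xi\|^2}\,d\xi ,$$ and $\mu_{h,\beta}:=w_\beta\,\mu_h$. For $\lambda>0$, $$S_\lambda(\xi,\eta):=\Big(\frac{\xi+\eta/\lambda}{\sqrt2},\frac{\xi-\eta/\lambda}{\sqrt2}\Big),$$ and $\bar w_{\beta_0}(\eta):=B_{\beta_0}^{-1}e^{-2\beta_0\|\eta\|^2}$. *)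

(* Defs.v *)
From HB Require Import structures.
From mathcomp Require Import all_boot all_order all_algebra.
From mathcomp Require Import all_classical all_reals all_analysis.
From mathcomp Require Import measurable_realfun.

Set Implicit Arguments.
Unset Strict Implicit.
Unset Printing Implicit Defensive.

Import Order.TTheory GRing.Theory Num.Theory.
Import numFieldNormedType.Exports.

Local Open Scope classical_set_scope.
Local Open Scope ring_scope.

(* R^n is 'rV[R]_n with its Borel sigma-algebra. *)
Section borel_rV.
Context (R : realType) (n : nat).

HB.instance Definition _ := @isMeasurable.Build
  (sigma_display (@open 'rV[R]_n)) 'rV[R]_n <<s @open 'rV[R]_n >>
  (@sigma_algebra0 _ setT _) (fun A => @sigma_algebraC _ _ A)
  (@sigma_algebra_bigcup _ _ _).

End borel_rV.

Section borel_rV_theory.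
Context {R : realType}.

Lemma open_measurable_rV n (U : set 'rV[R]_n) : open U -> measurable U.
Proof. exact: sub_sigma_algebra. Qed.

Lemma measurable_coord n (i : 'I_n) :
  measurable_fun setT (fun v : 'rV[R]_n => v 0 i).
Proof.
apply: (measurability _ (RGenOInfty.measurableE R)) => _ [_ [x ->] <-].
rewrite setTI; apply: open_measurable_rV; apply: open_comp => [v _|].
  exact: coord_continuous.
exact: interval_open.
Qed.

Lemma ball_rV n (v w : 'rV[R]_n) (e : R) : 0 < e ->
  ball v e w <-> forall i, ball (v 0 i) e (w 0 i).
Proof.
by move=> e0; split=> [[_ h] i|h]; [exact: h|split=> // i j; rewrite (ord1 i)].
Qed.

Lemma measurable_ball_rV n d (T : measurableType d) (f : T -> 'rV[R]_n) v e :
  (forall i, measurable_fun setT (fun x => f x 0 i)) ->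
  measurable (f @^-1` ball v e).
Proof.
move=> mf; have [e0|e0] := ltP 0 e; last first.
  rewrite [X in measurable X](_ : _ = set0)//.
  by apply/seteqP; split => // x [] /lt_geF; rewrite e0.
rewrite [X in measurable X](_ : _ = \big[setI/setT]_(i < n)
    ((fun x => f x 0 i) @^-1` ball (v 0 i) e)).
  apply: bigsetI_measurable => i _; rewrite -[X in measurable X]setTI.
  by apply: mf => //; apply: measurable_ball.
apply/seteqP; split => x.
  move=> /(ball_rV _ _ e0) h; rewrite -bigcap_seq => i _; exact: h.
rewrite -bigcap_seq => h; apply/ball_rV => // i; apply: h.
by rewrite /= mem_index_enum.
Qed.

Lemma ratr_approx n (v : 'rV[R]_n) (e : R) : 0 < e ->
  exists q : 'rV[rat]_n, ball (map_mx ratr q : 'rV[R]_n) e v.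
Proof.
move=> e0.
have h i : exists q : rat, ball (ratr q : R) e (v 0 i).
  have [||x [bx [q _ qx]]] := @dense_rat R (ball (v 0 i) e).
  - by exists (v 0 i); exact: ballxx.
  - exact: ball_open.
  by exists q; rewrite qx; exact: ball_sym.
exists (\row_i sval (cid (h i))); apply/ball_rV => // i.
by rewrite !mxE; case: cid.
Qed.

(* a countable base of balls *)
Lemma open_rVE n (U : set 'rV[R]_n) : open U ->
  U = \bigcup_(p in [set p : 'rV[rat]_n * nat |
                     ball (map_mx ratr p.1 : 'rV[R]_n) p.2.+1%:R^-1 `<=` U])
      ball (map_mx ratr p.1 : 'rV[R]_n) p.2.+1%:R^-1.
Proof.
move=> oU; apply/seteqP; split => [x Ux|x [p /= pU]]; last exact: pU.
have /nbhs_ballP[e /= e0 xU] : nbhs x U by exact: open_nbhs_nbhs.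
have e20 : 0 < e / 2 by exact: divr_gt0.
have [k _ /(_ k (leqnn k)) /= ke] := near_infty_natSinv_lt (PosNum e20).
have k0 : 0 < k.+1%:R^-1 :> R by rewrite invr_gt0.
have [q qx] := ratr_approx x k0.
exists (q, k) => //= y qy; apply: xU.
apply: (@le_ball _ _ _ (k.+1%:R^-1 + k.+1%:R^-1)).
  by rewrite (splitr e) lerD// ltW.
by apply: (ball_triangle _ qy); exact: ball_sym.
Qed.

Lemma measurable_fun_rV n d (T : measurableType d) (f : T -> 'rV[R]_n) :
  (forall i, measurable_fun setT (fun x => f x 0 i)) -> measurable_fun setT f.
Proof.
move=> mf; apply: (measurability (@open 'rV[R]_n)) => // _ [U oU <-].
rewrite setTI (open_rVE oU) preimage_bigcup bigcup_mkcond.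
apply: countable_bigcupT_measurable => // p; case: ifPn => // _.
exact: measurable_ball_rV.
Qed.

Lemma open_measurable_rVX m n (U : set ('rV[R]_m * 'rV[R]_n)) :
  open U -> measurable U.
Proof.
move=> oU; pose B (t : 'rV[rat]_m * 'rV[rat]_n * nat) :=
  ball (map_mx ratr t.1.1 : 'rV[R]_m) t.2.+1%:R^-1 `*`
  ball (map_mx ratr t.1.2 : 'rV[R]_n) t.2.+1%:R^-1.
rewrite [X in measurable X](_ : _ = \bigcup_(t in [set t | B t `<=` U]) B t).
  rewrite bigcup_mkcond; apply: countable_bigcupT_measurable => // t.
  case: ifPn => // _.
  by apply: measurableX; apply: open_measurable_rV; exact: ball_open.
apply/seteqP; split => [x Ux|x [t /= tU]]; last exact: tU.
have /nbhs_ballP[e /= e0 xU] : nbhs x U by exact: open_nbhs_nbhs.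
have e20 : 0 < e / 2 by exact: divr_gt0.
have [k _ /(_ k (leqnn k)) /= ke] := near_infty_natSinv_lt (PosNum e20).
have k0 : 0 < k.+1%:R^-1 :> R by rewrite invr_gt0.
have [p px] := ratr_approx x.1 k0; have [q qx] := ratr_approx x.2 k0.
exists (p, q, k) => //= y [/= py qy]; apply: xU.
apply: (@le_ball _ _ _ (k.+1%:R^-1 + k.+1%:R^-1)).
  by rewrite (splitr e) lerD// ltW.
by split; [apply: (ball_triangle _ py)|apply: (ball_triangle _ qy)];
  exact: ball_sym.
Qed.

(* the product sigma-algebra on R^m * R^n is the Borel one *)
Lemma measurable_rVXE m n :
  @measurable _ ('rV[R]_m * 'rV[R]_n)%type = <<s @open ('rV[R]_m * 'rV[R]_n)%type >>.
Proof.
apply/seteqP; split; last first.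
  apply: smallest_sub; first exact: sigma_algebra_measurable.
  by move=> U; exact: open_measurable_rVX.
pose T : measurableType _ := g_sigma_algebraType (@open ('rV[R]_m * 'rV[R]_n)%type).
have m1 : measurable_fun setT (fst : T -> 'rV[R]_m).
  apply: (measurability (@open 'rV[R]_m)) => // _ [U oU <-]; rewrite setTI.
  by apply: sub_sigma_algebra; apply: open_comp => // x _; exact: cvg_fst.
have m2 : measurable_fun setT (snd : T -> 'rV[R]_n).
  apply: (measurability (@open 'rV[R]_n)) => // _ [U oU <-]; rewrite setTI.
  by apply: sub_sigma_algebra; apply: open_comp => // x _; exact: cvg_snd.
apply: smallest_sub; first exact: smallest_sigma_algebra.
by move=> _ [|] [A mA <-]; [exact: m1|exact: m2].
Qed.

End borel_rV_theory.

(* Lebesgue measure on R^n, by iterated integration over the coordinates. *)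
Fixpoint leb {R : realType} {n : nat} : set 'rV[R]_n -> \bar R :=
  match n with
  | 0 => \d_(0 : 'rV[R]_0)
  | n'.+1 => fun A =>
      (\int[lebesgue_measure]_x
         leb [set v : 'rV[R]_n' | A (row_mx (x%:M : 'rV[R]_1) v)])%E
  end.

Section leb_measure.
Context {R : realType}.

Let cons_rV n (p : R * 'rV[R]_n) : 'rV[R]_n.+1 := row_mx (p.1%:M : 'rV[R]_1) p.2.

Let uncons_rV n (v : 'rV[R]_n.+1) : R * 'rV[R]_n :=
  (v 0 0, rsubmx (v : 'rV[R]_(1 + n))).

Let cons_rVK n : cancel (@cons_rV n) (@uncons_rV n).
Proof.
move=> [x v]; rewrite /uncons_rV /cons_rV /= row_mxKr; congr pair.
transitivity (row_mx (x%:M : 'rV[R]_1) v 0 (lshift n 0)).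
  by congr (row_mx _ _ _ _); exact/val_inj.
by rewrite row_mxEl mxE eqxx mulr1n.
Qed.

Let uncons_rVK n : cancel (@uncons_rV n) (@cons_rV n).
Proof.
move=> v; rewrite /cons_rV /uncons_rV /=.
suff -> : (v 0 0)%:M = lsubmx (v : 'rV[R]_(1 + n)) by exact: (@hsubmxK R 1 1 n).
apply/matrixP => i j; rewrite !mxE (ord1 i) (ord1 j) mulr1n.
by congr (v _ _); exact/val_inj.
Qed.

Let measurable_cons_rV n : measurable_fun setT (@cons_rV n).
Proof.
apply: measurable_fun_rV => i; rewrite /cons_rV.
case: (@split_ordP 1 n i) => j ->.
  rewrite [X in measurable_fun _ X](_ : _ = fst); first exact: measurable_fst.
  by apply/funext => x; rewrite (@row_mxEl _ 1 1 n) mxE (ord1 j) eqxx mulr1n.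
rewrite [X in measurable_fun _ X](_ : _ = (fun v : 'rV[R]_n => v 0 j) \o snd).
  by apply: measurableT_comp; [exact: measurable_coord|exact: measurable_snd].
by apply/funext => x; rewrite (@row_mxEr _ 1 1 n).
Qed.

Let measurable_uncons_rV n : measurable_fun setT (@uncons_rV n).
Proof.
apply: measurable_fun_pair => /=; first exact: measurable_coord.
apply: measurable_fun_rV => i; under eq_fun do rewrite mxE.
exact: measurable_coord.
Qed.

Let cons_measure n (mu : {sigma_finite_measure set 'rV[R]_n -> \bar R}) :
    set 'rV[R]_n.+1 -> \bar R :=
  pushforward (@lebesgue_measure R \x mu)%E (@cons_rV n).

Section cons_measure.
Context n (mu : {sigma_finite_measure set 'rV[R]_n -> \bar R}).

Let cons_measure0 : cons_measure mu set0 = 0%E.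
Proof. by rewrite /cons_measure /pushforward preimage_set0 measure0. Qed.

Let cons_measure_ge0 A : (0 <= cons_measure mu A)%E.
Proof. by apply: integral_ge0 => x _; exact: measure_ge0. Qed.

Let cons_measure_sigma_additive : semi_sigma_additive (cons_measure mu).
Proof.
have mc := @measurable_cons_rV n.
pose nu_f : {measure set 'rV[R]_n.+1 -> \bar R} :=
  [the {measure set _ -> \bar R} of cons_measure mu].
exact: (@measure_semi_sigma_additive _ _ _ (nu_f mc)).
Qed.

Let cons_measure_sigma_finite : sigma_finite setT (cons_measure mu).
Proof.
have /sigma_finiteP[F [TF ndF Foo]] := sigma_finiteT (@lebesgue_measure R).
have /sigma_finiteP[G [TG ndG Goo]] := sigma_finiteT mu.
exists (fun k => uncons_rV (n:=n) @^-1` (F k `*` G k)).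
  rewrite -preimage_bigcup; apply/esym/seteqP; split => // v _ /=.
  have [i _ Fi] : (\bigcup_i F i) (v 0 0) by rewrite -TF.
  have [j _ Gj] : (\bigcup_i G i) (uncons_rV v).2 by rewrite -TG.
  exists (maxn i j) => //; split.
  - by move: Fi; exact/subsetPset/ndF/leq_maxl.
  - by move: Gj; exact/subsetPset/ndG/leq_maxr.
move=> k; have [mFk Fk] := Foo k; have [mGk Gk] := Goo k; split.
  rewrite -[X in measurable X]setTI; apply: measurable_uncons_rV => //.
  exact: measurableX.
rewrite /cons_measure /pushforward -comp_preimage (_ : _ \o _ = id); last first.
  by apply/funext => x; exact: cons_rVK.
rewrite preimage_id.
by rewrite product_measure1E// lte_mul_pinfty// ge0_fin_numE.
Qed.

HB.instance Definition _ := isMeasure.Build _ _ _ (cons_measure mu)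
  cons_measure0 cons_measure_ge0 cons_measure_sigma_additive.

HB.instance Definition _ := Measure_isSigmaFinite.Build _ _ _
  (cons_measure mu) cons_measure_sigma_finite.

End cons_measure.

Let leb_ex n : exists mu : {sigma_finite_measure set 'rV[R]_n -> \bar R},
  @leb R n = mu.
Proof.
elim: n => [|n [mu mu_leb]]; first by exists \d_(0 : 'rV[R]_0).
exists (cons_measure mu); apply/funext => A.
rewrite /cons_measure /pushforward /product_measure1 /= mu_leb.
apply: eq_integral => x _ /=; congr (mu _).
by apply/seteqP; split => v; rewrite /xsection /= inE.
Qed.

Lemma leb0 n : @leb R n set0 = 0%E.
Proof. by have [mu ->] := leb_ex n; exact: measure0. Qed.

Lemma leb_ge0 n A : (0 <= @leb R n A)%E.
Proof. by have [mu ->] := leb_ex n; exact: measure_ge0. Qed.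

Lemma leb_sigma_additive n : semi_sigma_additive (@leb R n).
Proof. by have [mu ->] := leb_ex n; exact: measure_semi_sigma_additive. Qed.

Lemma leb_sigma_finite n : sigma_finite setT (@leb R n).
Proof. by have [mu ->] := leb_ex n; exact: sigma_finiteT. Qed.

HB.instance Definition _ n := isMeasure.Build _ _ _ (@leb R n)
  (@leb0 n) (@leb_ge0 n) (@leb_sigma_additive n).

HB.instance Definition _ n :=
  Measure_isSigmaFinite.Build _ _ _ (@leb R n) (@leb_sigma_finite n).

Lemma leb_box n (a b : 'rV[R]_n) : (forall i, a 0 i <= b 0 i) ->
  leb [set v : 'rV[R]_n | forall i, a 0 i < v 0 i <= b 0 i] =
  (\prod_(i < n) (b 0 i - a 0 i))%:E.
Proof.
elim: n a b => [|n IHn] a b ab.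
  by rewrite big_ord0 /= diracE mem_set// => -[].
rewrite big_ord_recl /=.
pose tl (v : 'rV[R]_n.+1) : 'rV[R]_n := \row_i v 0 (lift ord0 i).
pose box := [set v : 'rV[R]_n | forall i, tl a 0 i < v 0 i <= tl b 0 i].
transitivity (\int[@lebesgue_measure R]_x
    ((\1_(`]a 0 ord0, b 0 ord0]%classic) x)%:E * leb box))%E.
  apply: eq_integral => x _.
  have E0 (v : 'rV[R]_n) : row_mx (x%:M : 'rV[R]_1) v 0 (ord0 : 'I_n.+1) = x.
    by have := @cons_rVK n (x, v) => -[].
  have ES (v : 'rV[R]_n) i :
      row_mx (x%:M : 'rV[R]_1) v 0 (lift ord0 i : 'I_n.+1) = v 0 i.
    rewrite -[RHS](@row_mxEr _ 1 1 n (x%:M)); congr (row_mx _ _ _ _).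
    exact/val_inj.
  rewrite indicE; case: (boolP (x \in _)) => [|/negP] /=;
      rewrite inE /= in_itv /= => xab; rewrite ?mul1e ?mul0e.
    congr leb; apply/seteqP; split => v /= h i.
      by have := h (lift ord0 i); rewrite ES !mxE.
    case: (unliftP ord0 i) => [j ->|->]; first by have := h j; rewrite ES !mxE.
    by rewrite E0.
  rewrite (_ : [set _ | _] = set0) ?leb0//; apply/seteqP; split => // v /= h.
  by apply: xab; have := h ord0; rewrite E0.
have ab' i : tl a 0 i <= tl b 0 i by rewrite !mxE.
rewrite ge0_integralZr ?leb_ge0//; last first.
  by apply/measurable_EFinP; exact: measurable_indic.
rewrite integral_indic// setIT /= (lebesgue_measure_itv `]a 0 ord0, b 0 ord0]).
rewrite /= lte_fin /box IHn//.
rewrite (_ : (if _ then _ else _) = (b 0 ord0 - a 0 ord0)%:E); last first.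
  by case: ltgtP (ab ord0) => // -> _; rewrite subrr.
rewrite -EFinM; congr (_ * _)%:E.
by apply: eq_bigr => i _; rewrite !mxE.
Qed.

End leb_measure.

Notation phase_space R N := 'rV[R]_(2 * N)%N.

(* Integrability for the completed measure: the sigma-algebras above are the
   Borel ones, so a function is in L^1 when it agrees a.e. with an integrable
   Borel function.  On such functions the library integral, a difference of
   suprema over measurable simple functions, keeps its usual value. *)
Definition in_L1 d (T : measurableType d) (R : realType)
    (mu : {measure set T -> \bar R}) (D : set T) (f : T -> \bar R) :=
  exists2 g, mu.-integrable D g & f = g %[ae mu in D].

Definition atomic d (T : measurableType d) (R : realType)
    (c : nat -> {nonneg R}) (p : nat -> T) : set T -> \bar R :=
  mseries (fun i => mscale (c i) \d_(p i)) 0.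

HB.instance Definition _ d (T : measurableType d) (R : realType)
  (c : nat -> {nonneg R}) (p : nat -> T) := Measure.on (atomic c p).

Definition mean d (T : measurableType d) (R : realType)
    (mu : {measure set T -> \bar R}) (f : T -> R) : R :=
  (\int[mu]_x f x) / fine (mu setT).

Definition Cb (T : topologicalType) (R : realType) (f : T -> R) :=
  continuous f /\ bounded_fun f.

(* A form in {dot Z for idfun} is a real scalar product: bilinear, symmetric
   and positive definite.  It need not be the standard one, whereas leb always
   is the standard Lebesgue measure. *)
Section thermalization.
Context {R : realType} {n : nat}.
Local Notation Z := 'rV[R]_n.
Implicit Types (dot : {dot Z for idfun}) (p q : (Z * Z)%type).

Definition in_L1loc (f : Z * Z -> R) :=
  forall K, compact K -> in_L1 (leb \x leb)%E K (EFin \o f).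

Definition dnorm dot (u : Z) : R := Num.sqrt (dot u u).

Definition ddist dot p q : R :=
  Num.sqrt (dnorm dot (p.1 - q.1) ^+ 2 + dnorm dot (p.2 - q.2) ^+ 2).

Definition diam dot (A : set (Z * Z)) : \bar R :=
  ereal_sup [set (ddist dot p q)%:E | p in A & q in A].

(* B_beta *)
Definition gauss_mass dot (beta : R) : R :=
  \int[leb]_xi expR (- (beta * dnorm dot xi ^+ 2)).

(* w_beta *)
Definition weight dot (beta : R) p : R :=
  (gauss_mass dot beta)^-1 * expR (- (beta * dnorm dot (p.1 - p.2) ^+ 2)).

(* w_beta at points with y - z = sqrt 2 * eta *)
Definition weight_bar dot (beta : R) (eta : Z) : R :=
  (gauss_mass dot beta)^-1 * expR (- (2 * beta * dnorm dot eta ^+ 2)).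

(* S_lambda *)
Definition rot_scale (lambda : R) p : Z * Z :=
  ((Num.sqrt 2)^-1 *: (p.1 + lambda^-1 *: p.2),
   (Num.sqrt 2)^-1 *: (p.1 - lambda^-1 *: p.2)).

Definition thermalized dot (beta : R) (nu : {measure set (Z * Z) -> \bar R}) :
    set (Z * Z) -> \bar R :=
  fun A => (\int[nu]_(p in A) (weight dot beta p)%:E)%E.

Lemma weight_ge0 dot beta p : 0 <= weight dot beta p.
Proof.
rewrite mulr_ge0 ?expR_ge0// invr_ge0.
by apply: Rintegral_ge0 => // x _; exact: expR_ge0.
Qed.

Lemma dotE dot u v :
  dot u v = \sum_i \sum_j u 0 i * v 0 j * dot (delta_mx 0 i) (delta_mx 0 j).
Proof.
rewrite {1}(row_sum_delta u) linear_sumlz; apply: eq_bigr => i _.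
rewrite linearZl_LR /= {1}(row_sum_delta v) linear_sumr mulr_sumr.
by apply: eq_bigr => j _; rewrite linearZr_LR /= mulrA.
Qed.

Lemma measurable_dnorm dot : measurable_fun setT (dnorm dot).
Proof.
apply: (@measurableT_comp _ _ _ _ _ _ (@Num.sqrt R) _ (fun u => dot u u)).
  apply: continuous_measurable_fun; exact: sqrt_continuous.
rewrite [X in measurable_fun _ X](_ : _ = fun u : Z => \sum_i \sum_j
    u 0 i * u 0 j * dot (delta_mx 0 i) (delta_mx 0 j)).
  apply: measurable_sum => i; apply: measurable_sum => j.
  by apply: measurable_funM => //; apply: measurable_funM;
    exact: measurable_coord.
by apply/funext => u; rewrite dotE.
Qed.

Lemma measurable_weight dot beta : measurable_fun setT (weight dot beta).
Proof.
apply: measurable_funM => //; apply: measurableT_comp => //.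
apply: measurableT_comp => //; apply: measurable_funM => //.
apply: measurable_funX; apply: measurableT_comp; first exact: measurable_dnorm.
apply: measurable_fun_rV => i.
rewrite [X in measurable_fun _ X](_ : _ =
    ((fun u : Z => u 0 i) \o fst) \- ((fun u : Z => u 0 i) \o snd)).
  by apply: measurable_funB;
    (apply: measurableT_comp; first exact: measurable_coord).
by apply/funext => p; rewrite !mxE.
Qed.

Section thermalized_measure.
Context (dot : {dot Z for idfun}) (beta : R) (nu : {measure set (Z * Z) -> \bar R}).

Let thermalized0 : thermalized dot beta nu set0 = 0%E.
Proof. exact: integral_set0. Qed.

Let thermalized_ge0 A : (0 <= thermalized dot beta nu A)%E.
Proof. by apply: integral_ge0 => p _; rewrite lee_fin weight_ge0. Qed.

Let thermalized_sigma_additive : semi_sigma_additive (thermalized dot beta nu).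
Proof.
apply: semi_sigma_additive_nng_induced => [|p].
  by apply/measurable_EFinP; exact: measurable_weight.
by rewrite lee_fin weight_ge0.
Qed.

HB.instance Definition _ := isMeasure.Build _ _ _ (thermalized dot beta nu)
  thermalized0 thermalized_ge0 thermalized_sigma_additive.

End thermalized_measure.

End thermalization.

(* Main.v *)
(** In the rotated and scaled variables [p = rot_scale lambda (xi, eta)] with
    [lambda = sqrt (beta / beta0)], the weight [weight dot beta p] becomes, up
    to a constant depending only on [beta], the fixed Gaussian
    [exp (- 2 beta0 |eta|^2)], and that constant cancels in the quotient.
    Replacing the points [p] by the sample points of their cells changes
    [lambda (y - z)] by at most [2 lambda delta_h -> 0], hence the integrands
    converge a.e. to [exp (- 2 beta0 |eta|^2) f (xi / sqrt 2, xi / sqrt 2)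
    Lhat (xi / sqrt 2)], and they are dominated by a multiple of
    [ghat (xi) exp (- beta0 |eta|^2)].  Since [L] and [Lhat] are only a.e. equal
    to Borel functions, the integrals are taken over Borel versions. *)

Require Import Defs.
From mathcomp Require Import all_boot all_order all_algebra.
From mathcomp Require Import all_classical all_reals all_analysis.
From mathcomp Require Import measurable_realfun.
From mathcomp Require Import ring lra.

Set Implicit Arguments.
Unset Strict Implicit.
Unset Printing Implicit Defensive.

Import Order.TTheory GRing.Theory Num.Theory.
Import numFieldNormedType.Exports.

Local Open Scope classical_set_scope.
Local Open Scope ring_scope.

(** Each coefficient of the atomic measure is the integral of [L] over a cell. Hence its thermalized
    integrals are integrals of [L p] times [f] and the weight at the sample point of [p]: sampling
    disturbs only the continuous factors, while [L] stays at the unsampled point. The price is paid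
    in the domination. The Gaussian at a displaced point is not bounded by a multiple of the
    undisplaced one; the parallelogram identity gives up half of the exponent, which is why 2 beta0
    becomes beta0. The supremum over [eta] in (c) then bounds [L] along the rotated points uniformly
    in h. The scalar product is arbitrary, while [leb] is the standard measure and the topology is
    that of the maximum norm; coercivity of [dot] is the link between them. Integrals are handled
    for nonnegative [f], where Tonelli and the changes of variables hold without integrability
    conditions; a bounded [f] is reached at the end by adding a constant. *)

(** * Integrals and null sets *)

Section integral_ae.
Local Open Scope ereal_scope.
Context d (T : measurableType d) (R : realType) (mu : {measure set T -> \bar R}).
Import HBNNSimple.

(** Neither function has to be measurable: the integral of a nonnegative function is a supremum over
    the simple functions below it, and a simple function below [f], set to zero on the exceptional
    null set, lies below [g] and keeps its integral. *)
Lemma ge0_le_integral_ae (f g : T -> \bar R) :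
  (forall x, 0 <= f x) -> (forall x, 0 <= g x) ->
  {ae mu, forall x, f x <= g x} -> \int[mu]_x f x <= \int[mu]_x g x.
Proof.
move=> f0 g0 [N [mN muN subN]].
rewrite ge0_integralTE// [leRHS]ge0_integralTE//.
apply: ge_ereal_sup => _ [h /= hf <-].
have mNC : measurable (~` N) by exact: measurableC.
apply: ereal_sup_ubound; exists (proj_nnsfun h mNC) => /=.
  move=> x; rewrite mindicE; case: (boolP (x \in _)) => [|_] /=.
    rewrite inE /= => Nx; rewrite mulr1; apply: (le_trans (hf x)).
    by apply: contrapT => fg; apply: Nx; exact: subN.
  by rewrite mulr0.
rewrite -[LHS]integralT_nnsfun -[RHS]integralT_nnsfun.
apply: ae_eq_integral => //.
- by apply/measurable_EFinP.
- by apply/measurable_EFinP.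
exists N; split => // x /= /not_implyP[_ hx]; apply: contrapT => Nx; apply: hx.
by rewrite mindicE mem_set//= mulr1.
Qed.

(* [ae_eq_integral] asks for both functions to be measurable; the integral,
   being a supremum over simple functions, does not see null sets anyway. *)
Lemma eq_integral_ae (D : set T) (f g : T -> \bar R) :
  f = g %[ae mu in D] -> \int[mu]_(x in D) f x = \int[mu]_(x in D) g x.
Proof.
move=> fg; rewrite integralE [RHS]integralE.
have H (u v : T -> \bar R) : (forall x, 0 <= u x) -> (forall x, 0 <= v x) ->
    u = v %[ae mu in D] -> \int[mu]_(x in D) u x = \int[mu]_(x in D) v x.
  move=> u0 v0 uv; rewrite integral_mkcond [RHS]integral_mkcond.
  have u1 x : 0 <= (u \_ D) x by exact: erestrict_ge0.
  have v1 x : 0 <= (v \_ D) x by exact: erestrict_ge0.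
  by apply/eqP; rewrite eq_le; apply/andP; split; apply: ge0_le_integral_ae => //;
    apply: filterS uv => x; rewrite !patchE; case: ifPn => // /[!inE] Dx ->.
congr (_ - _); apply: H => //; apply: filterS fg => x /[apply] fgx.
  by rewrite !funeposE fgx.
by rewrite !funenegE fgx.
Qed.

End integral_ae.

Section ae_lemmas.
Local Open Scope ereal_scope.

Lemma ae_pushforward d d' (T : measurableType d) (T' : measurableType d')
    (R : realType) (mu : {measure set T -> \bar R})
    (nu : {measure set T' -> \bar R}) (phi : T -> T') (P : T' -> Prop) :
  measurable_fun setT phi ->
  (forall N, measurable N -> nu N = 0 -> mu (phi @^-1` N) = 0) ->
  {ae nu, forall y, P y} -> {ae mu, forall x, P (phi x)}.
Proof.
move=> mphi null [N [mN nuN subN]]; exists (phi @^-1` N); split.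
- by rewrite -[X in measurable X]setTI; exact: mphi.
- exact: null.
- by move=> x /= Px; exact: subN.
Qed.

Context d1 d2 (T1 : measurableType d1) (T2 : measurableType d2) (R : realType).
Context (m1 : {sigma_finite_measure set T1 -> \bar R}).
Context (m2 : {sigma_finite_measure set T2 -> \bar R}).

Lemma ae_prod_fst (P : T1 -> Prop) :
  {ae m1, forall x, P x} -> {ae (m1 \x m2), forall p, P p.1}.
Proof.
apply: ae_pushforward => [|N mN N0]; first exact: measurable_fst.
rewrite (_ : _ @^-1` _ = N `*` setT); last first.
  by apply/seteqP; split => x //= [].
by rewrite /= product_measure1E// N0 mul0e.
Qed.

(** Tonelli for the indicator of the exceptional set: the masses of its sections integrate to 0,
    hence vanish for a.e. [y]. *)
Lemma ae_prod_section (P : T1 * T2 -> Prop) : {ae (m1 \x m2), forall p, P p} ->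
  {ae m2, forall y, {ae m1, forall x, P (x, y)}}.
Proof.
move=> [N [mN N0 subN]].
have mys y : measurable (ysection N y) by exact: measurable_ysection.
have : \int[m2]_y m1 (ysection N y) = 0.
  have : \int[m1 \x m2]_z (\1_N z)%:E = 0.
    by rewrite integral_indic// setIT; exact: N0.
  rewrite fubini_tonelli2//; last first.
    by apply/measurable_EFinP; exact: measurable_indic.
  move=> <-.
  apply: eq_integral => y _; rewrite /fubini_G.
  rewrite -(setIT (ysection N y)) -integral_indic//.
  apply: eq_integral => x _; rewrite !indicE; congr (_%:R%:E).
  by rewrite mem_ysection.
have mf : measurable_fun setT (fun y => m1 (ysection N y)).
  exact: measurable_fun_ysection.
rewrite (eq_integral (fun y => `|m1 (ysection N y)|)); last first.
  by move=> y _; rewrite gee0_abs.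
move=> /(ae_eq_integral_abs m2 measurableT mf).
apply: filterS => y /(_ I) /= y0; exists (ysection N y); split => //.
by move=> x /= Px; rewrite /ysection /= inE; exact: subN.
Qed.

End ae_lemmas.

(** Reduces a change of variables to an identity between measures of sets; [k] plays the role of the
    Jacobian of [phi]. *)
Lemma ge0_integral_scaled_pushforward d d' (T : measurableType d)
    (T' : measurableType d') (R : realType) (mu : {measure set T -> \bar R})
    (nu : {measure set T' -> \bar R}) (phi : T -> T') (k : {nonneg R})
    (F : T' -> \bar R) :
  measurable_fun setT phi ->
  (forall X, measurable X -> nu X = (k%:num%:E * mu (phi @^-1` X))%E) ->
  measurable_fun setT F -> (forall y, 0 <= F y)%E ->
  (\int[nu]_y F y = k%:num%:E * \int[mu]_x F (phi x))%E.
Proof.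
move=> mphi nuE mF F0.
pose push : {measure set T' -> \bar R} :=
  @measure_function_pushforward__canonical__measure_function_Measure
    _ _ _ _ _ mu phi mphi.
transitivity (\int[mscale k push]_y F y)%E.
  by apply: eq_measure_integral => X mX _; rewrite nuE.
by rewrite ge0_integral_mscale//= ge0_integral_pushforward.
Qed.

(** * Affine changes of variables for Lebesgue measure *)

Section leb_cons.
Context {R : realType}.

Definition cons_rV n (p : R * 'rV[R]_n) : 'rV[R]_n.+1 :=
  row_mx (p.1%:M : 'rV[R]_1) p.2.

Lemma cons_rV0 n (p : R * 'rV[R]_n) : cons_rV p 0 ord0 = p.1.
Proof.
rewrite (_ : ord0 = lshift n (0 : 'I_1)); last exact/val_inj.
by rewrite [LHS](@row_mxEl _ 1 1 n) mxE eqxx mulr1n.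
Qed.

Lemma cons_rVS n (p : R * 'rV[R]_n) i : cons_rV p 0 (lift ord0 i) = p.2 0 i.
Proof.
rewrite (_ : lift ord0 i = rshift 1 i); last exact/val_inj.
by rewrite [LHS](@row_mxEr _ 1 1 n).
Qed.

Lemma measurable_cons_rV n : measurable_fun setT (@cons_rV n).
Proof.
apply: measurable_fun_rV => i; case: (unliftP ord0 i) => [j|] ->.
  under eq_fun do rewrite cons_rVS.
  apply: (measurableT_comp (f := fun v : 'rV[R]_n => v 0 j)).
    exact: measurable_coord.
  exact: measurable_snd.
under eq_fun do rewrite cons_rV0.
exact: measurable_fst.
Qed.

(** By its recursive definition, [leb] in dimension n+1 is the image of a product measure under
    [cons_rV], with Jacobian 1; Tonelli does the rest. *)
Lemma ge0_integral_leb_cons n (F : 'rV[R]_n.+1 -> \bar R) :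
  measurable_fun setT F -> (forall v, 0 <= F v)%E ->
  (\int[leb]_v F v =
   \int[lebesgue_measure]_x \int[leb]_v F (cons_rV (x, v)))%E.
Proof.
move=> mF F0.
have mFc : measurable_fun setT (F \o @cons_rV n).
  by apply: measurableT_comp => //; exact: measurable_cons_rV.
rewrite (ge0_integral_scaled_pushforward (k := 1%:nng)
    (mu := (@lebesgue_measure R \x @leb R n)%E) (@measurable_cons_rV n))//.
  have h := @fubini_tonelli1 _ _ _ _ R (@lebesgue_measure R)
    (@leb R n) (F \o @cons_rV n) mFc (fun p => F0 _).
  rewrite mul1e. exact: h.
move=> X mX; rewrite mul1e /= /product_measure1.
apply: eq_integral => x _; congr (leb _).
by apply/seteqP; split => v; rewrite /xsection /= inE.
Qed.

(** The image of Lebesgue measure under the affine map, multiplied by |a|, gives each half-open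
    interval its length, so by uniqueness it is Lebesgue measure. *)
Lemma ge0_integral_lebesgue_affine (a b : R) (F : R -> \bar R) :
  a != 0 -> measurable_fun setT F -> (forall x, 0 <= F x)%E ->
  (\int[lebesgue_measure]_x F (a * x + b)%R =
   `|a|^-1%:E * \int[lebesgue_measure]_x F x)%E.
Proof.
move=> a0 mF F0; pose T := measurableTypeR R.
pose g : T -> T := fun x => a * x + b.
have mg : measurable_fun setT g.
  by apply: measurable_funD => //; exact: measurable_funM.
have a'0 : 0 <= `|a| by [].
pose k : {nonneg R} := NngNum a'0.
pose push : {measure set T -> \bar R} :=
  @measure_function_pushforward__canonical__measure_function_Measure
    _ _ _ _ _ (@lebesgue_measure R) g mg.
pose mu : {measure set T -> \bar R} := mscale k push.
have muE (A : set T) : measurable A -> lebesgue_measure A = mu A.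
  apply: lebesgue_measure_unique => _ [[c d]] _ <-.
  transitivity (`|a|%:E * lebesgue_measure (g @^-1` `]c, d]))%E; last by [].
  have [a_lt0|a_gt0|] := ltgtP a 0; last by move/eqP; rewrite (negPf a0).
    (* A negative slope reverses the interval, so its preimage is closed on the left and open on the
       right. *)
    rewrite (_ : g @^-1` _ = `[(d - b) / a, (c - b) / a[%classic); last first.
      apply/seteqP; split => x; rewrite /= !in_itv /= /g.
        by rewrite ler_ndivrMr// ltr_ndivlMr// mulrC lerBrDr ltrBlDr andbC.
      by rewrite ler_ndivrMr// ltr_ndivlMr// mulrC lerBrDr ltrBlDr andbC.
    rewrite !lebesgue_measure_itv /= !lte_fin ltr_nM2r ?invr_lt0// ltrD2r.
    case: ifP => _; last by rewrite mule0.
    by rewrite -EFinD -EFinM ltr0_norm// EFinD; congr EFin; field.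
  rewrite (_ : g @^-1` _ = `](c - b) / a, (d - b) / a]%classic); last first.
    apply/seteqP; split => x; rewrite /= !in_itv /= /g.
      by rewrite ltr_pdivrMr// ler_pdivlMr// mulrC lerBrDr ltrBlDr.
    by rewrite ltr_pdivrMr// ler_pdivlMr// mulrC lerBrDr ltrBlDr.
  rewrite !lebesgue_measure_itv /= !lte_fin ltr_pM2r ?invr_gt0// ltrD2r.
  case: ifP => _; last by rewrite mule0.
  by rewrite -EFinD -EFinM gtr0_norm// EFinD; congr EFin; field.
rewrite [in RHS](ge0_integral_scaled_pushforward (k := k) mg muE)//.
by rewrite muleA -EFinM /= mulVf ?mul1e// normr_eq0.
Qed.

(** Induction on the dimension, each coordinate contributing one factor |a|^-1. The translation is
    what makes the lemma applicable to the shears in [ge0_integral_rot_scale]. *)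
Lemma ge0_integral_leb_affine n (a : R) (b : 'rV[R]_n) (F : 'rV[R]_n -> \bar R) :
  a != 0 -> measurable_fun setT F -> (forall x, 0 <= F x)%E ->
  (\int[leb]_v F (a *: v + b)%R = (`|a|^-1 ^+ n)%:E * \int[leb]_v F v)%E.
Proof.
move=> a0; elim: n b F => [|n IHn] b F mF F0.
  rewrite expr0 mul1e; apply: eq_integral => v _; congr (F _).
  by apply/matrixP => i [].
have maff m (c : 'rV[R]_m) : measurable_fun setT (fun v : 'rV[R]_m => a *: v + c).
  apply: measurable_fun_rV => i.
  rewrite (_ : (fun _ => _) = (fun v : 'rV[R]_m => a * v 0 i + c 0 i)).
    apply: measurable_funD => //; apply: measurable_funM => //.
    exact: measurable_coord.
  by apply/funext => v; rewrite !mxE.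
have mcx (x : R) : measurable_fun setT (fun v : 'rV[R]_n => cons_rV (x, v)).
  by apply: measurableT_comp; [exact: measurable_cons_rV|exact: measurable_pair1].
pose tl := \row_i b 0 (lift ord0 i) : 'rV[R]_n.
have consE x v : a *: cons_rV (x, v) + b = cons_rV (a * x + b 0 ord0, a *: v + tl).
  apply/rowP => i; rewrite [LHS]mxE [X in X + _]mxE.
  by case: (unliftP ord0 i) => [j|] ->; rewrite ?cons_rVS ?cons_rV0 ?mxE.
rewrite ge0_integral_leb_cons//; last exact: measurableT_comp.
have mFc : measurable_fun setT (F \o @cons_rV n).
  by apply: measurableT_comp => //; exact: measurable_cons_rV.
pose G x := (\int[leb]_v F (cons_rV (x, v)))%E.
have mG : measurable_fun setT G.
  exact: (@measurable_fun_fubini_tonelli_F _ _ _ _ R (@leb R n)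
    (F \o @cons_rV n) mFc (fun p => F0 _)).
have G0 x : (0 <= G x)%E by exact: integral_ge0.
transitivity (\int[lebesgue_measure]_x
    ((`|a|^-1 ^+ n)%:E * G (a * x + b 0 ord0)%R))%E.
  apply: eq_integral => x _; under eq_integral do rewrite consE.
  by rewrite (IHn tl (fun v => F (cons_rV (a * x + b 0 ord0, v))))//;
    exact: measurableT_comp.
rewrite ge0_integralZl//; last first.
  have mg : measurable_fun setT (fun x : R => a * x + b 0 ord0).
    by apply: measurable_funD => //; exact: measurable_funM.
  exact: (measurableT_comp mG mg).
rewrite ge0_integral_lebesgue_affine// muleA -EFinM -exprSr.
by rewrite (ge0_integral_leb_cons mF F0).
Qed.

End leb_cons.

(** * The Jacobian of the rotation and scaling, and its action on null sets *)

Section rot_scale.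
Context {R : realType}.

Lemma measurable_rVD n d (T : measurableType d) (f g : T -> 'rV[R]_n) :
  measurable_fun setT f -> measurable_fun setT g ->
  measurable_fun setT (fun x => f x + g x).
Proof.
move=> mf mg; apply: measurable_fun_rV => i; under eq_fun do rewrite mxE.
by apply: measurable_funD; [exact: (measurableT_comp (measurable_coord i) mf)|
  exact: (measurableT_comp (measurable_coord i) mg)].
Qed.

Lemma measurable_rVZ n d (T : measurableType d) (a : R) (f : T -> 'rV[R]_n) :
  measurable_fun setT f -> measurable_fun setT (fun x => a *: f x).
Proof.
move=> mf; apply: measurable_fun_rV => i; under eq_fun do rewrite mxE.
apply: measurable_funM => //; exact: (measurableT_comp (measurable_coord i) mf).
Qed.

Context {n : nat}.
Local Notation Z := 'rV[R]_n.

Lemma measurable_rot_scale (lam : R) :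
  measurable_fun setT (rot_scale lam : Z * Z -> Z * Z).
Proof.
have m1 : measurable_fun setT (fst : Z * Z -> Z) by exact: measurable_fst.
have m2 : measurable_fun setT (snd : Z * Z -> Z) by exact: measurable_snd.
rewrite /rot_scale; under eq_fun do rewrite -scaleNr.
apply: measurable_fun_pair => /=; apply: measurable_rVZ;
  apply: measurable_rVD => //; exact: measurable_rVZ.
Qed.

(** The map splits into two affine maps of one variable. For fixed [eta], u = s xi + (s / lam) eta
    costs s^-n; the second component is then u - t eta with t = 2 s / lam, which for fixed u costs
    t^-n. As s^2 = 1/2, s t = 1 / lam. *)
Lemma ge0_integral_rot_scale (lam : R) (F : Z * Z -> \bar R) : 0 < lam ->
  measurable_fun setT F -> (forall p, 0 <= F p)%E ->
  (\int[leb \x leb]_p F (rot_scale lam p) =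
   (lam ^+ n)%:E * \int[leb \x leb]_p F p)%E.
Proof.
move=> lam0 mF F0; pose s : R := (Num.sqrt 2)^-1; pose t := 2 * s * lam^-1.
have s0 : s != 0 by rewrite invr_neq0// gt_eqF// sqrtr_gt0.
have t0 : - t != 0 by rewrite oppr_eq0 !mulf_neq0// invr_neq0// gt_eqF.
have m1 : measurable_fun setT (fst : Z * Z -> Z) by exact: measurable_fst.
have m2 : measurable_fun setT (snd : Z * Z -> Z) by exact: measurable_snd.
pose H (p : Z * Z) := F (p.1, - t *: p.2 + p.1).
have mH : measurable_fun setT H.
  apply: (measurableT_comp mF); apply: measurable_fun_pair => //=.
  by apply: measurable_rVD => //; exact: measurable_rVZ.
have H0 p : (0 <= H p)%E by exact: F0.
transitivity (\int[leb]_eta \int[leb]_xi H (s *: xi + (s * lam^-1) *: eta, eta)%R)%E.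
  pose FS := F \o rot_scale lam.
  have mFS : measurable_fun setT FS.
    exact: (measurableT_comp mF (measurable_rot_scale lam)).
  transitivity (\int[leb]_eta fubini_G leb FS eta)%E.
    exact: (@fubini_tonelli2 _ _ _ _ R (@leb R n) (@leb R n) FS mFS (fun=> F0 _)).
  apply: eq_integral => eta _; apply: eq_integral => xi _.
  rewrite /H /rot_scale /=; congr (F (_, _)).
    by rewrite scalerDr scalerA.
  by apply/rowP => i; rewrite !mxE -/s /t; ring.
under eq_integral => eta _.
  rewrite (@ge0_integral_leb_affine _ _ _ _ (fun u => H (u, eta)))//; last first.
    exact: (measurableT_comp mH (measurable_pair2 _)).
  over.
rewrite ge0_integralZl//; last 2 first.
- exact: (@measurable_fun_fubini_tonelli_G _ _ _ _ R (@leb R n) H mH H0).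
- by move=> w _; exact: integral_ge0.
rewrite -(fubini_tonelli H mH H0).
under eq_integral => u _.
  rewrite (@ge0_integral_leb_affine _ _ _ _ (fun v => F (u, v)))//; last first.
    exact: (measurableT_comp mF (measurable_pair1 _)).
  over.
rewrite ge0_integralZl//; last 2 first.
- exact: (@measurable_fun_fubini_tonelli_F _ _ _ _ R (@leb R n) F mF F0).
- by move=> w _; exact: integral_ge0.
rewrite (fubini_tonelli1 F mF F0) muleA -EFinM -exprMn; congr ((_ ^+ _)%:E * _)%E.
rewrite -invfM normrN -normrM.
have ss : s * s = 2^-1 by rewrite -expr2 exprVn sqr_sqrtr.
have -> : s * t = lam^-1.
  rewrite /t (_ : s * _ = 2 * (s * s) * lam^-1); last by ring.
  by rewrite ss divff ?mul1r// pnatr_eq0.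
by rewrite gtr0_norm ?invr_gt0// invrK.
Qed.

(** Carries a.e. statements about [L] over to [L (rot_scale lam p)], by the change of variables
    applied to an indicator. *)
Lemma null_preimage_rot_scale (lam : R) (N : set (Z * Z)) : 0 < lam ->
  measurable N -> (leb \x leb)%E N = 0%E ->
  (leb \x leb)%E (rot_scale lam @^-1` N) = 0%E.
Proof.
move=> lam0 mN N0.
have mSN : measurable (rot_scale lam @^-1` N).
  by rewrite -[X in measurable X]setTI; exact: measurable_rot_scale.
have mI : measurable_fun setT (EFin \o \1_N : Z * Z -> \bar R).
  by apply/measurable_EFinP; exact: measurable_indic.
have I0 p : (0 <= (EFin \o \1_N : Z * Z -> \bar R) p)%E by rewrite lee_fin.
have := ge0_integral_rot_scale lam0 mI I0.
rewrite [X in (_ * X)%E](_ : _ = 0%E); last first.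
  by rewrite integral_indic// setIT; exact: N0.
rewrite mule0 => <-.
transitivity (\int[leb \x leb]_p (\1_(rot_scale lam @^-1` N) p)%:E)%E => //.
by rewrite integral_indic// setIT.
Qed.

Lemma null_preimage_scale (a : R) (N : set Z) : a != 0 -> measurable N ->
  leb N = 0%E -> leb ((fun v => a *: v) @^-1` N) = 0%E.
Proof.
move=> a0 mN N0.
have mSN : measurable ((fun v => a *: v) @^-1` N).
  by rewrite -[X in measurable X]setTI; exact: measurable_rVZ.
have mI : measurable_fun setT (EFin \o \1_N : Z -> \bar R).
  by apply/measurable_EFinP; exact: measurable_indic.
have I0 v : (0 <= (EFin \o \1_N : Z -> \bar R) v)%E by rewrite lee_fin.
have := ge0_integral_leb_affine 0 a0 mI I0.
rewrite [X in (_ * X)%E](_ : _ = 0%E); last first.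
  by rewrite integral_indic// setIT; exact: N0.
rewrite mule0 => <-.
under eq_integral do rewrite addr0.
transitivity (\int[leb]_v (\1_((fun v => a *: v) @^-1` N) v)%:E)%E => //.
by rewrite integral_indic// setIT.
Qed.

End rot_scale.

(** * Scalar products and Gaussian integrals *)

Section scalar_product.
Context {R : realType} {n : nat} (dot : {dot 'rV[R]_n for idfun}).
Local Notation Z := 'rV[R]_n.
Implicit Types u v : Z.

Lemma dotvv_ge0 u : 0 <= dot u u.
Proof.
have [->|u0] := eqVneq u 0; first by rewrite linear0l.
by rewrite ltW// neq0_dnorm_gt0.
Qed.

Lemma sqr_dnorm u : dnorm dot u ^+ 2 = dot u u.
Proof. by rewrite sqr_sqrtr// dotvv_ge0. Qed.

Lemma dotvvZ a u : dot (a *: u) (a *: u) = a ^+ 2 * dot u u.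
Proof. by rewrite linearZl_LR /= linearZr_LR /= mulrA. Qed.

Lemma dotvv_parallelogram u v :
  dot (u + v) (u + v) + dot (u - v) (u - v) = 2 * dot u u + 2 * dot v v.
Proof. by rewrite !(linearDl, linearDr, linearNl, linearNr) /=; ring. Qed.

Lemma continuous_dotvv : continuous (fun u => dot u u).
Proof.
have addc : continuous (fun x : R^o * R^o => x.1 + x.2) by exact: add_continuous.
rewrite (_ : (fun u => _) = fun u : Z => \sum_i \sum_j
    u 0 i * u 0 j * dot (delta_mx 0 i) (delta_mx 0 j)); last first.
  by apply/funext => u; rewrite dotE.
have term_continuous i j :
    continuous (fun u : Z => u 0 i * u 0 j * dot (delta_mx 0 i) (delta_mx 0 j)).
  move=> u; apply: (@continuousM R Z (fun u => u 0 i * u 0 j) (fun=> _)).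
    apply: (@continuousM R Z (fun u => u 0 i) (fun u => u 0 j));
      exact: coord_continuous.
  exact: cst_continuous.
by apply: continuous_big => // i _; apply: continuous_big.
Qed.

(** The quadratic form attains a positive minimum on the compact unit sphere of the maximum norm;
    homogeneity extends the bound to all vectors. *)
Lemma dotvv_coercive : exists2 k : R, 0 < k & forall u, k * `|u| ^+ 2 <= dot u u.
Proof.
pose S := [set u : Z | `|u| = 1].
(* If the sphere is empty, 0 is the only vector and any positive constant serves. *)
have [S0|/set0P/negP/negPn/eqP S0] := pselect (S !=set0); last first.
  exists 1 => // u; suff -> : u = 0 by rewrite normr0 linear0l expr0n mulr0.
  apply: contrapT => /eqP u0; have : S (`|u|^-1 *: u).
    by rewrite /S /= normrZ normfV normr_id mulVf// normr_eq0.
  by rewrite S0.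
have cS : compact S.
  apply: bounded_closed_compact.
    by exists 1; split => // M M1 u /= ->; exact: ltW.
  rewrite (_ : S = (fun u : Z => `|u|) @^-1` [set x | x = 1])//.
  apply: closed_comp; last exact: closed_eq.
  by move=> u _; exact: norm_continuous.
have [|c /[!inE] Sc minc] := compact_EVT_min S0 cS (f := fun u => dot u u).
  by apply: continuous_subspaceT; exact: continuous_dotvv.
have c0 : c != 0.
  apply/eqP => c0; move: Sc.
  by rewrite /S /= c0 normr0 => /esym/eqP; rewrite oner_eq0.
exists (dot c c); first exact: neq0_dnorm_gt0.
move=> u; have [->|u0] := eqVneq u 0.
  by rewrite normr0 expr0n mulr0 linear0l.
have nu0 : `|u| != 0 by rewrite normr_eq0.
have := minc (`|u|^-1 *: u); rewrite inE => /(_ _)/wrap[].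
  by rewrite /S /= normrZ normfV normr_id mulVf.
rewrite dotvvZ exprVn mulrC ler_pdivlMr//.
by rewrite exprn_gt0// normr_gt0.
Qed.

End scalar_product.

Section gaussian.
Context {R : realType}.

Lemma norm_coord_le n (v : 'rV[R]_n) i : `|v 0 i| <= `|v|.
Proof.
rewrite [leRHS]/Num.norm /= mx_normrE.
by apply: (le_bigmax (0 : R) (fun ij => `|v ij.1 ij.2|) (0, i)).
Qed.

Lemma measurable_prod_coord n (phi : R -> R) : measurable_fun setT phi ->
  measurable_fun setT (fun v : 'rV[R]_n => \prod_i phi (v 0 i)).
Proof.
move=> mphi; apply: measurable_prod => i _.
exact: (measurableT_comp mphi (measurable_coord i)).
Qed.

Lemma integral_leb_prod n (phi : R -> R) : measurable_fun setT phi ->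
  (forall x, 0 <= phi x) ->
  (\int[lebesgue_measure]_x (phi x)%:E < +oo)%E ->
  (\int[leb]_(v in @setT 'rV[R]_n) (\prod_i phi (v 0 i))%:E < +oo)%E.
Proof.
move=> mphi phi0 phioo; elim: n => [|n IHn].
  under eq_integral do rewrite big_ord0.
  by rewrite integral_cst//= diracT mul1e ltry.
rewrite ge0_integral_leb_cons//; last 2 first.
- by apply/measurable_EFinP; exact: measurable_prod_coord.
- by move=> v; rewrite lee_fin prodr_ge0.
pose I := (\int[leb]_(v in @setT 'rV[R]_n) (\prod_i phi (v 0 i))%:E)%E.
rewrite (eq_integral (fun x : measurableTypeR R => (phi x)%:E * I)%E); last first.
  move=> x _; rewrite -ge0_integralZl ?lee_fin//; last 2 first.
  - by apply/measurable_EFinP; exact: measurable_prod_coord.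
  - by move=> v _; rewrite lee_fin prodr_ge0.
  apply: eq_integral => v _; rewrite big_ord_recl cons_rV0 EFinM.
  by congr (_ * _%:E)%E; apply: eq_bigr => i _; rewrite cons_rVS.
have I0 : (0 <= I)%E by apply: integral_ge0 => v _; rewrite lee_fin prodr_ge0.
have mphiE : measurable_fun setT (fun x : measurableTypeR R => (phi x)%:E).
  exact/measurable_EFinP.
have phiE0 (x : measurableTypeR R) : setT x -> (0 <= (phi x)%:E)%E.
  by rewrite lee_fin.
rewrite ge0_integralZr//.
rewrite lte_mul_pinfty//.
  by apply: integral_ge0 => x _; rewrite lee_fin.
by rewrite ge0_fin_numE//; apply: integral_ge0 => x _; rewrite lee_fin.
Qed.

Lemma integral_lebesgue_gauss (k : R) : 0 < k ->
  (\int[lebesgue_measure]_x (expR (- (k * x ^+ 2)))%:E < +oo)%E.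
Proof.
move=> k0.
have sk0 : Num.sqrt k != 0 by rewrite gt_eqF// sqrtr_gt0.
have -> : (fun x => (expR (- (k * x ^+ 2)))%:E) =
    (fun x => (gauss_fun (Num.sqrt k * x + 0))%:E).
  by apply/funext => x; rewrite /gauss_fun addr0 exprMn sqr_sqrtr// ltW.
rewrite (ge0_integral_lebesgue_affine _ (F := EFin \o gauss_fun))//=.
- by rewrite integralT_gauss -EFinM ltry.
- by apply/measurable_EFinP; exact: measurable_gauss_fun.
- by move=> x; rewrite lee_fin gauss_fun_ge0.
Qed.

(** Makes the a.e. filter of [leb] proper, so that an a.e. property holds at some point. *)
Lemma leb_setT_gt0 n : (0 < leb (@setT 'rV[R]_n))%E.
Proof.
elim: n => [|n IHn]; first by rewrite /= diracT.
have -> : leb (@setT 'rV[R]_n.+1) =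
    (\int[@lebesgue_measure R]_x leb (@setT 'rV[R]_n))%E by [].
rewrite integral_cst// mule_gt0// -set_itvNyy.
rewrite [X in (_ < X)%E](lebesgue_measure_itv `]-oo, +oo[).
by rewrite /= addye// lt0y.
Qed.

Context {n : nat} (dot : {dot 'rV[R]_n for idfun}).

Lemma measurable_gauss (b : R) :
  measurable_fun setT (fun u : 'rV[R]_n => expR (- (b * dot u u))).
Proof.
under eq_fun do rewrite -sqr_dnorm.
do 2 apply: measurableT_comp => //; apply: measurable_funM => //.
by apply: measurable_funX; exact: measurable_dnorm.
Qed.

(** By coercivity and the bound of the sum of squares by n |u|^2, the Gaussian of [dot] lies below a
    product of one-dimensional Gaussians. *)
Lemma integral_gauss_lty (b : R) : 0 < b ->
  (\int[leb]_(u in @setT 'rV[R]_n) (expR (- (b * dot u u)))%:E < +oo)%E.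
Proof.
move=> b0; have [k k0 hk] := dotvv_coercive dot.
(* Dividing by n+1 rather than n keeps [c] positive in dimension 0. *)
pose c := b * k / (n.+1)%:R.
have c0 : 0 < c by rewrite divr_gt0 ?mulr_gt0.
pose phi x := expR (- (c * x ^+ 2)).
have mphi : measurable_fun setT phi.
  apply: measurableT_comp => //; apply: measurableT_comp => //.
  by apply: measurable_funM => //; exact: measurable_funX.
apply: le_lt_trans (@integral_leb_prod n phi mphi _ (integral_lebesgue_gauss c0)).
  apply: ge0_le_integral => //.
  - by apply/measurable_EFinP; exact: measurable_gauss.
  - by apply/measurable_EFinP; exact: measurable_prod_coord.
  move=> u _; rewrite lee_fin -expR_sum ler_expR.
  rewrite sumrN lerN2 -mulr_sumr.
  apply: (@le_trans _ _ (b * (k * `|u| ^+ 2))); last by rewrite ler_pM2l.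
  have le1 : \sum_(i < n) u 0 i ^+ 2 <= n%:R * `|u| ^+ 2.
    apply: (@le_trans _ _ (\sum_(i < n) `|u| ^+ 2)).
      apply: ler_sum => i _; rewrite -real_normK ?num_real//.
      by rewrite lerXn2r ?nnegrE ?norm_coord_le.
    by rewrite sumr_const card_ord mulr_natl.
  rewrite [leRHS]mulrA /c mulrAC -[leLHS]mulrA ler_pM2l ?mulr_gt0//.
  rewrite ler_pdivrMr// (le_trans le1)// mulrC ler_wpM2l ?exprn_ge0//.
  by rewrite ler_nat.
by move=> x; exact: expR_ge0.
Qed.

(** A zero integral would make the positive integrand vanish a.e., hence at some point. *)
Lemma integral_gauss_gt0 (b : R) :
  (0 < \int[leb]_(u in @setT 'rV[R]_n) (expR (- (b * dot u u)))%:E)%E.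
Proof.
rewrite lt0e integral_ge0 ?andbT; last by move=> u _; rewrite lee_fin expR_ge0.
apply/eqP => I0.
have mE : measurable_fun setT (fun u : 'rV[R]_n => (expR (- (b * dot u u)))%:E).
  by apply/measurable_EFinP; exact: measurable_gauss.
have [+ _] := ae_eq_integral_abs leb measurableT mE.
rewrite (eq_integral (fun u : 'rV[R]_n => (expR (- (b * dot u u)))%:E)).
  move=> /(_ I0) h; have pf := ae_properfilter_algebraOfSetsType (leb_setT_gt0 n).
  have [u /(_ I) /= /eqP] := @filter_ex _ _ pf _ h.
  by rewrite eqe gt_eqF// expR_gt0.
by move=> u _; rewrite gee0_abs// lee_fin expR_ge0.
Qed.

Lemma gauss_mass_gt0 (b : R) : 0 < b -> 0 < gauss_mass dot b.
Proof.
move=> b0; rewrite /gauss_mass /Rintegral.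
under eq_integral do rewrite sqr_dnorm.
by rewrite fine_gt0// integral_gauss_gt0 integral_gauss_lty.
Qed.

End gaussian.

(** * Borel versions of L and Lhat *)

Section borel_versions.
Context {R : realType} {n : nat}.
Local Notation Z := 'rV[R]_n.

Lemma measurable_continuous_rVX (f : Z * Z -> R) :
  continuous f -> measurable_fun setT f.
Proof.
move=> cf; apply: (measurability _ (RGenOInfty.measurableE R)) => _ [_ [x ->] <-].
rewrite setTI; apply: open_measurable_rVX; apply: open_comp => [p _|].
  exact: cf.
exact: interval_open.
Qed.

Lemma compact_cylinder (k : R) :
  compact [set p : Z * Z | `|p.1| <= k /\ `|p.2| <= k].
Proof.
have cB : compact [set u : Z | `|u| <= k].
  apply: bounded_closed_compact.
    exists k; split; first exact: num_real.
    by move=> M kM u /= /le_trans; apply; exact: ltW.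
  apply: (@closed_comp _ _ (fun u : Z => `|u|) [set x | x <= k]).
    by move=> u _; exact: norm_continuous.
  exact: closed_le.
by rewrite (_ : [set p | _] = [set u : Z | `|u| <= k] `*` [set u : Z | `|u| <= k]);
  [exact: compact_setX|].
Qed.

Lemma measurable_norm_rV : measurable_fun setT (fun u : Z => `|u|).
Proof.
apply: (measurability _ (RGenOInfty.measurableE R)) => _ [_ [x ->] <-].
rewrite setTI; apply: open_measurable_rV; apply: open_comp => [p _|].
  exact: norm_continuous.
exact: interval_open.
Qed.

Lemma measurable_cylinder (k : R) :
  measurable [set p : Z * Z | `|p.1| <= k /\ `|p.2| <= k].
Proof.
have mB : measurable [set u : Z | `|u| <= k].
  rewrite (_ : [set u | _] = setT `&` (fun u : Z => `|u|) @^-1` `]-oo, k]%classic).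
    by apply: measurable_norm_rV => //; exact: measurable_itv.
  by rewrite setTI; apply/seteqP; split => u; rewrite /= in_itv.
by rewrite (_ : [set p | _] = [set u : Z | `|u| <= k] `*` [set u : Z | `|u| <= k]);
  [exact: measurableX|].
Qed.

Lemma fine_limn_esup_ge0 (u : (\bar R)^nat) :
  (forall k, 0 <= u k)%E -> 0 <= fine (limn_esup u).
Proof.
move=> u0; apply: fine_ge0; rewrite limn_esup_lim.
apply: lime_ge; first exact: is_cvg_esups.
near=> m; apply: ereal_sup_ge; exists (u m) => //.
by exists m => //=.
Unshelve. all: by end_near. Qed.

(** The hypothesis yields one Borel version per compact set. Along an exhaustion by the sets [K k],
    these versions, extended by zero, are at a.e. point eventually equal to [L]. *)
Lemma in_L1loc_borel (L : Z * Z -> R) : in_L1loc L -> (forall p, 0 <= L p) ->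
  exists Lb : Z * Z -> R, [/\ measurable_fun setT Lb, forall p, 0 <= Lb p &
    {ae (leb \x leb)%E, forall p, L p = Lb p}].
Proof.
move=> Lloc L0; pose K k := [set p : Z * Z | `|p.1| <= k%:R /\ `|p.2| <= k%:R].
have mK k : measurable (K k) by exact: measurable_cylinder.
have /choice[g gP] k : exists g, (leb \x leb)%E.-integrable (K k) g /\
    (EFin \o L) = g %[ae (leb \x leb)%E in K k].
  by have [g] := Lloc _ (@compact_cylinder k%:R); exists g.
(* The upper limit is defined and measurable everywhere, and the absolute value makes it nonnegative
   also on the exceptional null set. *)
pose G p := limn_esup (fun k => `|(g k \_ (K k)) p|%E).
have mG : measurable_fun setT G.
  apply: measurable_fun_limn_esup => k; apply: measurableT_comp => //.
  apply/(measurable_restrictT _ _).1 => //.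
  exact: (measurable_int _ (gP k).1).
exists (fine \o G); split => [|p|].
- by apply: measurableT_comp => //; exact: fine_measurable.
- by apply: fine_limn_esup_ge0.
have := ae_foralln (fun k => (gP k).2); apply: filterS => p h.
have [k0 k0p] : exists k, K k p.
  exists (Num.truncn (Num.max `|p.1| `|p.2|)).+1.
  by split; apply: (le_trans _ (ltW (truncnS_gt _))); rewrite le_max lexx ?orbT.
rewrite /= /G.
suff -> : limn_esup (fun k => `|(g k \_ (K k)) p|%E) = (L p)%:E by [].
have /cvg_limn_einf_sup[] // : `|(g k \_ (K k)) p|%E @[k --> \oo] --> (L p)%:E.
apply: cvg_near_cst; near=> k; rewrite patchE mem_set; last first.
  have kk : k0%:R <= k%:R :> R by rewrite ler_nat; near: k; exact: nbhs_infty_ge.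
  by case: k0p => ? ?; split; apply: le_trans kk.
rewrite -(h k) /= ?ger0_norm//.
have kk : k0%:R <= k%:R :> R by rewrite ler_nat; near: k; exact: nbhs_infty_ge.
by case: k0p => ? ?; split; apply: le_trans kk.
Unshelve. all: by end_near. Qed.

(* By Fubini, for a.e. eta the section at eta of an a.e. equality in (xi, eta)
   is an a.e. equality in xi; one such section gives the Borel version. *)
Lemma diagonal_limit_borel (L Lb : Z * Z -> R) (Lhat : Z -> R) :
  measurable_fun setT Lb -> (forall p, 0 <= Lb p) ->
  {ae (leb \x leb)%E, forall p, L p = Lb p} ->
  {ae (leb \x leb)%E, forall p : Z * Z, L (rot_scale lambda p) @[lambda --> +oo] -->
     Lhat ((Num.sqrt 2)^-1 *: p.1)} ->
  exists Lh : Z -> R, [/\ measurable_fun setT Lh, forall u, 0 <= Lh u &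
    {ae leb, forall u, Lhat u = Lh u}].
Proof.
move=> mLb Lb0 LLb Llim; pose s : R := (Num.sqrt 2)^-1.
have s0 : s != 0 by rewrite invr_neq0// gt_eqF// sqrtr_gt0.
(* An upper limit along a sequence stays measurable; starting from 1 keeps the scales positive, so
   that [rot_scale] pulls null sets back to null sets. *)
pose lam (h : nat) : R := h.+1%:R.
have lam0 h : 0 < lam h by [].
have lamoo : lam h @[h --> \oo] --> +oo.
  by rewrite (cvg_shiftS (fun h : nat => h%:R : R)); exact: cvgr_idn.
pose G p := limn_esup (fun h => (Lb (rot_scale (lam h) p))%:E).
have mG : measurable_fun setT G.
  apply: measurable_fun_limn_esup => h; apply/measurable_EFinP.
  exact: (measurableT_comp mLb (measurable_rot_scale _)).
have LG : {ae (leb \x leb)%E, forall p, Lhat (s *: p.1) = fine (G p)}.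
  have : {ae (leb \x leb)%E, forall p h,
      L (rot_scale (lam h) p) = Lb (rot_scale (lam h) p)}.
    apply: ae_foralln => h.
    apply: (ae_pushforward (P := fun p => L p = Lb p) (measurable_rot_scale _) _ LLb).
    by move=> N; exact: null_preimage_rot_scale.
  apply: filterS2 Llim => p /cvg_pinftyP/(_ _ lamoo) Lp LLp.
  rewrite /G; suff /cvg_limn_einf_sup[_ ->] : (Lb (rot_scale (lam h) p))%:E @[h --> \oo]
    --> (Lhat (s *: p.1))%:E by [].
  apply: cvg_EFin; first exact: nearW.
  by rewrite /comp /=; under eq_fun do rewrite -LLp.
have pf := ae_properfilter_algebraOfSetsType (@leb_setT_gt0 R n).
have [eta0 eta0P] := @filter_ex _ _ pf _ (ae_prod_section LG).
(* The limit gives [Lhat] at [s *: v]; the substitution v = s^-1 u undoes the factor, and scalings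
   preserve null sets. *)
exists (fun u => fine (G (s^-1 *: u, eta0))); split.
- apply: measurableT_comp; first exact: fine_measurable.
  apply: (measurableT_comp mG).
  apply: measurable_fun_pair => //=; exact: measurable_rVZ.
- by move=> u; apply: fine_limn_esup_ge0 => h; rewrite lee_fin.
have {}eta0P : {ae leb, forall v : Z, Lhat (s *: v) = fine (G (v, eta0))} := eta0P.
have mscale : measurable_fun setT (fun u : Z => s^-1 *: u) by exact: measurable_rVZ.
have := ae_pushforward mscale _ eta0P.
move=> /(_ leb (fun N => @null_preimage_scale R n s^-1 N (invr_neq0 s0))).
by apply: filterS => u; rewrite scalerA divff// scale1r.
Qed.

End borel_versions.

(** * Step functions and atomic measures *)

Section partition_step.
Context d (T : measurableType d) (R : realType) (A : nat -> set T).
Context (A_part : partition setT A setT) (A_meas : forall i, measurable (A i)).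

Lemma pblock_indexP x : A (pblock_index setT A x) x.
Proof.
have [cA _ _] := A_part; have : (\bigcup_i A i) x by rewrite [\bigcup_i _]cA.
move=> [i _ Aix]; have /getPex[] // : exists i, setT i /\ A i x by exists i.
Qed.

Lemma pblock_indexE i x : A i x -> pblock_index setT A x = i.
Proof.
have [_ /trivIsetP tA _] := A_part => Aix.
apply: contrapT => /eqP ne; have := tA _ _ I I ne.
by rewrite -subset0 => /(_ x); apply; split => //; exact: pblock_indexP.
Qed.

Lemma measurable_fun_step d' (T' : measurableType d') (y : nat -> T') :
  measurable_fun setT (fun x => y (pblock_index setT A x)).
Proof.
have [cA _ _] := A_part; rewrite -cA.
apply/(measurable_fun_bigcup _ A_meas) => i.
apply: (eq_measurable_fun (cst (y i))) => [x /[!inE] Aix|]; last exact: measurable_cst.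
by rewrite (pblock_indexE Aix).
Qed.

(** Turns the discrete sum into an integral in which [L] is taken at [x] itself and only [a] is read
    off the cell of [x]. *)
Lemma ge0_integral_step (mu : {measure set T -> \bar R}) (L : T -> R)
    (c : nat -> {nonneg R}) (a : nat -> R) :
  measurable_fun setT L -> (forall x, 0 <= L x) -> (forall i, 0 <= a i) ->
  (forall i, (c i)%:num%:E = \int[mu]_(x in A i) (L x)%:E)%E ->
  (\sum_(0 <= i <oo) (a i * (c i)%:num)%:E =
   \int[mu]_x (L x * a (pblock_index setT A x))%:E)%E.
Proof.
move=> mL L0 a0 cE; have [cA tA _] := A_part.
rewrite -[in RHS]cA /cover ge0_integral_bigcup//; last 2 first.
- rewrite [\bigcup_i _]cA; apply/measurable_EFinP; apply: measurable_funM => //.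
  exact: measurable_fun_step.
- by move=> x _; rewrite lee_fin mulr_ge0.
have mLE i : measurable_fun (A i) (fun x => (L x)%:E).
  by apply/measurable_EFinP; exact: measurable_funTS.
have LE0 i x : A i x -> (0 <= (L x)%:E)%E by rewrite lee_fin.
apply: eq_eseriesr => i _; rewrite EFinM cE -ge0_integralZl ?lee_fin//; last exact: LE0.
apply: eq_integral => x /[!inE] Aix.
by rewrite (pblock_indexE Aix) -EFinM mulrC.
Qed.

End partition_step.

Section atomic_thermalized.
Context {R : realType}.

Lemma integral_scaled_dirac d (T : measurableType d) (k : {nonneg R}) (y : T)
    (f : T -> R) : measurable_fun setT f ->
  (\int[mscale k \d_y]_x (f x)%:E = (f y * k%:num)%:E)%E.
Proof.
move=> mf; have mfE : measurable_fun setT (EFin \o f) by exact/measurable_EFinP.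
have mp := measurable_funepos mfE; have mn := measurable_funeneg mfE.
rewrite integralE (ge0_integral_mscale _ measurableT k mp)//.
rewrite (ge0_integral_mscale _ measurableT k mn)//.
rewrite (integral_dirac _ measurableT mp) (integral_dirac _ measurableT mn).
rewrite diracT !mul1e funeposE funenegE /= -!EFin_max -!EFinM -EFinB.
rewrite -mulrBr mulrC; congr (_ * _)%:E.
by rewrite /Num.max; case: ltP => ?; case: ltP => ?; lra.
Qed.

Context {n : nat} (dot : {dot 'rV[R]_n for idfun}) (b : R).
Local Notation Z := 'rV[R]_n.
Context (c : nat -> {nonneg R}) (y : nat -> (Z * Z)%type).

Definition thermalized_coef i : {nonneg R} :=
  ((c i)%:num * (NngNum (weight_ge0 dot b (y i)))%:num)%:nng.

Lemma thermalized_atomicE X : measurable X ->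
  thermalized dot b (atomic c y) X = atomic thermalized_coef y X.
Proof.
move=> mX; rewrite /thermalized.
rewrite /atomic ge0_integral_measure_series//; last 2 first.
- by move=> p _; rewrite lee_fin weight_ge0.
- by apply/measurable_EFinP; apply: measurable_funTS; exact: measurable_weight.
apply: eq_eseriesr => i _; rewrite ge0_integral_mscale//; last 2 first.
- by apply/measurable_EFinP; apply: measurable_funTS; exact: measurable_weight.
- by move=> p _; rewrite lee_fin weight_ge0.
rewrite integral_dirac//; last first.
  by apply/measurable_EFinP; apply: measurable_funTS; exact: measurable_weight.
by rewrite /mscale /= EFinM [(\d_ _ _ * _)%E]muleC muleA.
Qed.

Lemma ge0_integral_thermalized_atomic (f : Z * Z -> R) :
  measurable_fun setT f -> (forall p, 0 <= f p) ->
  (\int[thermalized dot b (atomic c y)]_p (f p)%:E =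
   \sum_(0 <= i <oo) (f (y i) * (c i)%:num * weight dot b (y i))%:E)%E.
Proof.
move=> mf f0.
rewrite (eq_measure_integral (atomic thermalized_coef y)); last first.
  by move=> X mX _; exact: thermalized_atomicE.
have mfE : measurable_fun setT (fun p => (f p)%:E) by exact/measurable_EFinP.
have fE0 (p : Z * Z) : setT p -> (0 <= (f p)%:E)%E by rewrite lee_fin.
rewrite ge0_integral_measure_series//.
apply: eq_eseriesr => i _; rewrite integral_scaled_dirac//.
by rewrite /= mulrA.
Qed.

(** For signed [f], integrating against a series of measures requires summability of the positive
    and negative parts; both series are at most [M] times the finite total mass. *)
Lemma integral_thermalized_atomic (f : Z * Z -> R) (M : R) :
  (thermalized dot b (atomic c y) setT < +oo)%E ->
  measurable_fun setT f -> (forall p, `|f p| <= M) ->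
  (\int[thermalized dot b (atomic c y)]_p (f p)%:E =
   \sum_(0 <= i <oo) (f (y i) * (c i)%:num * weight dot b (y i))%:E)%E.
Proof.
move=> foo mf fM.
rewrite (eq_measure_integral (atomic thermalized_coef y)); last first.
  by move=> X mX _; exact: thermalized_atomicE.
have mfE : measurable_fun setT (EFin \o f) by exact/measurable_EFinP.
have M0 : 0 <= M by rewrite (le_trans _ (fM (y 0))).
have cM : (\sum_(0 <= i <oo) (M * (thermalized_coef i)%:num)%:E < +oo)%E.
  under eq_eseriesr do rewrite EFinM.
  rewrite nneseriesZl; last by move=> i _; rewrite lee_fin.
  apply: lte_mul_pinfty; rewrite ?lee_fin//.
  move: foo; rewrite thermalized_atomicE// /atomic /mseries.
  rewrite (_ : \big[_/_]_(_ <= _ <oo) _ =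
    \sum_(0 <= i <oo) ((thermalized_coef i)%:num)%:E)%E//.
  apply: eq_eseriesr => i _; rewrite -[RHS]mule1; congr (_ * _)%E.
  exact: diracT.
have integrable_dirac i :
    (mscale (thermalized_coef i) \d_(y i)).-integrable setT (EFin \o f).
  apply/integrableP; split => //.
  rewrite (_ : (fun p => _) = (fun p => (`|f p|)%:E))//.
  by rewrite integral_scaled_dirac ?ltry//; exact: measurableT_comp.
have bnd (g : Z * Z -> R) : measurable_fun setT g -> (forall p, 0 <= g p) ->
    (forall p, g p <= M) ->
    (\sum_(0 <= i <oo) `|\int[mscale (thermalized_coef i) \d_(y i)]_p (g p)%:E| < +oo)%E.
  move=> mg g0 gM; apply: le_lt_trans cM; apply: lee_nneseries => [i _ _|i _].
    exact: abse_ge0.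
  have k0 : 0 <= (thermalized_coef i)%:num by [].
  rewrite integral_scaled_dirac//= ger0_norm; last by rewrite mulr_ge0.
  by rewrite lee_fin; exact: ler_wpM2r.
pose m i : {measure set (Z * Z) -> \bar R} := mscale (thermalized_coef i) \d_(y i).
transitivity (\sum_(0 <= i <oo) \int[m i]_p (f p)%:E)%E; last first.
  by apply: eq_eseriesr => i _; rewrite integral_scaled_dirac//= mulrA.
apply: (@integral_measure_series _ _ R m _ measurableT (EFin \o f)) => //.
- rewrite (_ : (EFin \o f)^\- = (fun p => (Num.max (- f p) 0)%:E))%E; last first.
    by apply/funext => p; rewrite funenegE EFin_max.
  apply: bnd.
  + by apply: measurable_maxr => //; exact: measurableT_comp.
  + by move=> p; rewrite le_max lexx orbT.
  + by move=> p; rewrite ge_max M0 andbT (le_trans _ (fM p))// -normrN ler_norm.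
- rewrite (_ : (EFin \o f)^\+ = (fun p => (Num.max (f p) 0)%:E))%E; last first.
    by apply/funext => p; rewrite funeposE EFin_max.
  apply: bnd.
  + exact: measurable_maxr.
  + by move=> p; rewrite le_max lexx orbT.
  + by move=> p; rewrite ge_max M0 andbT (le_trans _ (fM p))// ler_norm.
Qed.

End atomic_thermalized.

(** * The limit of the rescaled integrals *)

Section product_integral.
Local Open Scope ereal_scope.
Context d1 d2 (T1 : measurableType d1) (T2 : measurableType d2) (R : realType).
Context (m1 : {sigma_finite_measure set T1 -> \bar R}).
Context (m2 : {sigma_finite_measure set T2 -> \bar R}).

Lemma ge0_integral_prod_fun (a : T1 -> \bar R) (b : T2 -> \bar R) :
  measurable_fun setT a -> measurable_fun setT b ->
  (forall x, 0 <= a x) -> (forall y, 0 <= b y) ->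
  \int[m1 \x m2]_p (a p.1 * b p.2) = \int[m1]_x a x * \int[m2]_y b y.
Proof.
move=> ma mb a0 b0; pose F (p : T1 * T2) := a p.1 * b p.2.
have mF : measurable_fun setT F.
  apply: emeasurable_funM.
    exact: (measurableT_comp ma measurable_fst).
  exact: (measurableT_comp mb measurable_snd).
have F0 p : 0 <= F p by rewrite /F mule_ge0.
rewrite (fubini_tonelli1 F mF F0) -ge0_integralZr//; last exact: integral_ge0.
by apply: eq_integral => x _; rewrite /fubini_F /F /= ge0_integralZl.
Qed.

End product_integral.

Section thermalized_limit.
Context {R : realType} {n : nat} (dot : {dot 'rV[R]_n for idfun}).
Local Notation Z := 'rV[R]_n.
Local Notation s := ((Num.sqrt 2)^-1 : R).
Context (Lb : Z * Z -> R) (mLb : measurable_fun setT Lb) (Lb0 : forall p, 0 <= Lb p).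
Context (Lh : Z -> R) (mLh : measurable_fun setT Lh) (Lh0 : forall u, 0 <= Lh u).
Context (lam : nat -> R) (lam_gt0 : forall h, 0 < lam h).
Context (lam_oo : lam h @[h --> \oo] --> +oo).
Context (b0 : R) (b0_gt0 : 0 < b0).
Context (Lb_cvg : {ae (leb \x leb)%E, forall p : Z * Z,
  Lb (rot_scale (lam h) p) @[h --> \oo] --> Lh (s *: p.1)}).
Context (g : Z -> \bar R) (ig : leb.-integrable setT g).
Context (Lb_le : {ae (leb \x leb)%E, forall p : Z * Z, forall h,
  ((Lb (rot_scale (lam h) p))%:E <= g p.1)%E}).
(** [T h] stands for the map from a point to the sample point of its cell, and [eps h] for lambda_h
    times the largest cell diameter; [g] above stands for a Borel version of the supremum in (c). *)
Context (T : nat -> Z * Z -> Z * Z) (mT : forall h, measurable_fun setT (T h)).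
Context (eps : nat -> R) (eps_cvg : eps h @[h --> \oo] --> 0).
Context (T_close : \forall h \near \oo, forall p,
  lam h ^+ 2 * (dot (p.1 - (T h p).1) (p.1 - (T h p).1) +
                dot (p.2 - (T h p).2) (p.2 - (T h p).2)) <= eps h ^+ 2).
Context (f : Z * Z -> R) (cf : continuous f) (f_ge0 : forall p, 0 <= f p).
Context (M : R) (f_le : forall p, f p <= M).

(** The factor [lam h] inside [dot] turns [b0] into beta_h = [b0 * lam h ^+ 2], so the exponential
    is the unnormalized weight at the sample point. *)
Definition scaled_integrand h (p : Z * Z) : R :=
  let t := T h (rot_scale (lam h) p) in
  Lb (rot_scale (lam h) p) *
  (f t * expR (- (b0 * dot (lam h *: (t.1 - t.2)) (lam h *: (t.1 - t.2))))).

Definition limit_integrand (p : Z * Z) : R :=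
  f (s *: p.1, s *: p.1) * Lh (s *: p.1) * expR (- (2 * b0 * dot p.2 p.2)).

Lemma sqr_invsqrt2 : s ^+ 2 = 2^-1.
Proof. by rewrite exprVn sqr_sqrtr. Qed.

(** Displacements caused by sampling, magnified by [lam h]: this is the scale at which the weight
    sees them. *)
Let w1 h p := lam h *: ((T h (rot_scale (lam h) p)).1 - (rot_scale (lam h) p).1).
Let w2 h p := lam h *: ((T h (rot_scale (lam h) p)).2 - (rot_scale (lam h) p).2).

Lemma rot_scale_shift h p : lam h *: ((T h (rot_scale (lam h) p)).1 -
    (T h (rot_scale (lam h) p)).2) = (2 * s) *: p.2 + (w1 h p - w2 h p).
Proof.
rewrite /w1 /w2; case: (T h _) => t1 t2 /=.
have l0 : lam h != 0 by rewrite gt_eqF.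
by apply/rowP => i; rewrite !mxE; set r := s; field.
Qed.

Lemma dot_shift_le : \forall h \near \oo, forall p,
  dot (w1 h p) (w1 h p) <= eps h ^+ 2 /\ dot (w2 h p) (w2 h p) <= eps h ^+ 2.
Proof.
apply: filterS T_close => h Th p; have := Th (rot_scale (lam h) p).
rewrite /w1 /w2 !dotvvZ; case: (T h _) => t1 t2; case: (rot_scale _ p) => y z /=.
have dotB (u v : Z) : dot (u - v) (u - v) = dot (v - u) (v - u).
  by rewrite -opprB linearNl linearNr /= opprK.
rewrite (dotB y) (dotB z) mulrDr => H.
have l2 : 0 <= lam h ^+ 2 by rewrite exprn_ge0 ?ltW.
by split; apply: le_trans H; rewrite ?lerDl ?lerDr mulr_ge0 ?dotvv_ge0.
Qed.

(** Convergence is in the maximum norm; coercivity gives k |u|^2 <= eps^2, so |u| < e as soon as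
    |eps| < e sqrt k. *)
Lemma cvg0_of_dot (u : nat -> Z) :
  (\forall h \near \oo, dot (u h) (u h) <= eps h ^+ 2) -> u h @[h --> \oo] --> (0 : Z).
Proof.
move=> ule; have [k k0 hk] := dotvv_coercive dot.
apply/cvgr0Pnorm_lt => e e0.
have /cvgr0Pnorm_lt : eps h @[h --> \oo] --> 0 by exact: eps_cvg.
have ek0 : 0 < e * Num.sqrt k by rewrite mulr_gt0// sqrtr_gt0.
move=> /(_ _ ek0); apply: filterS2 ule => h ule epse.
suff : k * `|u h| ^+ 2 < k * e ^+ 2.
  by rewrite ltr_pM2l// ltr_pXn2r// nnegrE// ltW.
apply: (le_lt_trans (hk _)); apply: (le_lt_trans ule).
rewrite -[eps h ^+ 2]real_normK ?num_real//.
rewrite (_ : k * e ^+ 2 = (e * Num.sqrt k) ^+ 2).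
  by rewrite ltr_pXn2r// nnegrE// ltW.
by rewrite exprMn sqr_sqrtr ?ltW// mulrC.
Qed.

Lemma w1_cvg p : w1 h p @[h --> \oo] --> (0 : Z).
Proof. by apply: cvg0_of_dot; apply: filterS dot_shift_le => h /(_ p)[]. Qed.

Lemma w2_cvg p : w2 h p @[h --> \oo] --> (0 : Z).
Proof. by apply: cvg0_of_dot; apply: filterS dot_shift_le => h /(_ p)[]. Qed.

Lemma lamV_cvg : (lam h)^-1 @[h --> \oo] --> 0.
Proof.
by apply/gtr0_cvgV0 => //; exact: nearW.
Qed.

(** Both the [eta] part of the rotated point and the displacement to its sample are of order 1 /
    [lam h], so the two components merge on the diagonal. *)
Lemma T_rot_scale_cvg p : T h (rot_scale (lam h) p) @[h --> \oo] -->
  (s *: p.1, s *: p.1).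
Proof.
have -> : (fun h => T h (rot_scale (lam h) p)) = (fun h =>
    (s *: (p.1 + (lam h)^-1 *: p.2) + (lam h)^-1 *: w1 h p,
     s *: (p.1 - (lam h)^-1 *: p.2) + (lam h)^-1 *: w2 h p)).
  apply/funext => h; rewrite /w1 /w2 /rot_scale /=.
  rewrite !scalerA mulVf ?gt_eqF// !scale1r ![_ + (_ - _)]addrC !subrK.
  by case: (T h _).
have lV := lamV_cvg; have c1 := w1_cvg p; have c2 := w2_cvg p.
have Z0 (w : nat -> Z) : w h @[h --> \oo] --> (0 : Z) ->
    (lam h)^-1 *: w h @[h --> \oo] --> (0 : Z).
  by move=> wc; rewrite -(scaler0 _ 0); apply: cvgZ.
have e0 : (lam h)^-1 *: p.2 @[h --> \oo] --> (0 : Z).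
  by rewrite -(scale0r p.2); apply: cvgZr_tmp.
have cA : s *: (p.1 + (lam h)^-1 *: p.2) + (lam h)^-1 *: w1 h p @[h --> \oo] --> s *: p.1.
  rewrite -[X in _ --> X]addr0 -[X in s *: X]addr0.
  apply: cvgD; last exact: Z0.
  by apply: cvgZl_tmp; apply: cvgD => //; exact: cvg_cst.
have cB : s *: (p.1 - (lam h)^-1 *: p.2) + (lam h)^-1 *: w2 h p @[h --> \oo] --> s *: p.1.
  rewrite -[X in _ --> X]addr0 -[X in s *: X]subr0.
  apply: cvgD; last exact: Z0.
  by apply: cvgZl_tmp; apply: cvgB => //; exact: cvg_cst.
exact: (cvg_pair cA cB).
Qed.

Lemma scaled_integrand_cvg : {ae (leb \x leb)%E, forall p : Z * Z,
  scaled_integrand h p @[h --> \oo] --> limit_integrand p}.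
Proof.
apply: filterS Lb_cvg => p Lp; pose t h := T h (rot_scale (lam h) p).
have cft : f (t h) @[h --> \oo] --> f (s *: p.1, s *: p.1).
  exact: (cvg_comp t f (@T_rot_scale_cvg p) (@cf (s *: p.1, s *: p.1))).
pose u h := lam h *: ((t h).1 - (t h).2).
have cu : u h @[h --> \oo] --> (2 * s) *: p.2 + (0 - 0).
  rewrite (_ : u = fun h => (2 * s) *: p.2 + (w1 h p - w2 h p)); last first.
    by apply/funext => h; rewrite /u /t rot_scale_shift.
  apply: cvgD; first exact: cvg_cst.
  by apply: cvgB; [exact: w1_cvg|exact: w2_cvg].
have cdot : dot (u h) (u h) @[h --> \oo] --> 2 * dot p.2 p.2.
  rewrite (_ : 2 * _ = dot ((2 * s) *: p.2 + (0 - 0)) ((2 * s) *: p.2 + (0 - 0))).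
    exact: (cvg_comp u (fun v => dot v v) cu (@continuous_dotvv _ _ dot _)).
  by rewrite subrr addr0 dotvvZ exprMn sqr_invsqrt2; field.
have cexp : expR (- (b0 * dot (u h) (u h))) @[h --> \oo] -->
    expR (- (2 * b0 * dot p.2 p.2)).
  apply: (cvg_comp _ expR _ (@continuous_expR R _)).
  rewrite (_ : 2 * b0 * _ = b0 * (2 * dot p.2 p.2)); last by ring.
  by apply: cvgN; apply: cvgM => //; exact: cvg_cst.
rewrite (_ : limit_integrand p = Lh (s *: p.1) * (f (s *: p.1, s *: p.1) *
    expR (- (2 * b0 * dot p.2 p.2)))); last by rewrite mulrCA mulrA.
exact: (cvgM Lp (cvgM cft cexp)).
Qed.

Lemma scaled_integrand_ge0 h p : 0 <= scaled_integrand h p.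
Proof. by rewrite /scaled_integrand !mulr_ge0// expR_ge0. Qed.

Lemma measurable_scaled_integrand h : measurable_fun setT (scaled_integrand h).
Proof.
have mS := @measurable_rot_scale R n (lam h).
have mTS := measurableT_comp (mT h) mS.
apply: measurable_funM; first exact: (measurableT_comp mLb mS).
apply: measurable_funM.
  exact: (measurableT_comp (measurable_continuous_rVX cf) mTS).
apply: (measurableT_comp (measurable_gauss dot b0)).
apply: measurable_rVZ; under eq_fun do rewrite -scaleN1r.
apply: measurable_rVD; last apply: measurable_rVZ.
  exact: (measurableT_comp measurable_fst mTS).
exact: (measurableT_comp measurable_snd mTS).
Qed.

Lemma measurable_limit_integrand : measurable_fun setT limit_integrand.
Proof.
have ms : measurable_fun setT (fun p : Z * Z => s *: p.1).
  by apply: measurable_rVZ; exact: measurable_fst.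
apply: measurable_funM; first apply: measurable_funM.
- apply: (measurableT_comp (measurable_continuous_rVX cf)).
  exact: measurable_fun_pair.
- exact: (measurableT_comp mLh ms).
exact: (measurableT_comp (measurable_gauss dot (2 * b0)) measurable_snd).
Qed.

(** The factor exp (4 b0) pays for the displacements [w1] and [w2], of length at most 1 each for
    large h. The absolute value makes the function nonnegative where [g], known only up to null
    sets, may not be. *)
Definition dominating_fun (p : Z * Z) : \bar R :=
  ((M * expR (4 * b0))%:E * (`|g p.1| * (expR (- (b0 * dot p.2 p.2)))%:E))%E.

Lemma integrable_dominating_fun : (leb \x leb)%E.-integrable setT dominating_fun.
Proof.
have mg : measurable_fun setT (fun u => `|g u|%E).
  by apply: measurableT_comp => //; exact: (measurable_int _ ig).
have mE : measurable_fun setT (fun u : Z => (expR (- (b0 * dot u u)))%:E).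
  by apply/measurable_EFinP; exact: measurable_gauss.
apply: integrableZl => //; apply/integrableP; split.
  apply: emeasurable_funM; first exact: (measurableT_comp mg measurable_fst).
  exact: (measurableT_comp mE measurable_snd).
rewrite (eq_integral (fun p : Z * Z => `|g p.1| * (expR (- (b0 * dot p.2 p.2)))%:E)%E);
    last first.
  by move=> p _; rewrite gee0_abs// mule_ge0// lee_fin expR_ge0.
have E0 (u : Z) : (0 <= (expR (- (b0 * dot u u)))%:E)%E by rewrite lee_fin expR_ge0.
rewrite [ltLHS](ge0_integral_prod_fun (@leb R n) (@leb R n) mg mE)//.
apply: lte_mul_pinfty; first exact: integral_ge0.
- by rewrite ge0_fin_numE; [have /integrableP[] := ig|exact: integral_ge0].
- exact: integral_gauss_lty.
Qed.

Lemma scaled_integrand_dominated : \forall h \near \oo,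
  {ae (leb \x leb)%E, forall p, (`|(scaled_integrand h p)%:E| <= dominating_fun p)%E}.
Proof.
have M0 : 0 <= M by exact: le_trans (f_le 0).
near=> h.
have eps1 : eps h ^+ 2 <= 1.
  rewrite -real_normK ?num_real// expr_le1// ltW//; near: h.
  by have /cvgr0Pnorm_lt := eps_cvg; apply.
have dle : forall p, dot (w1 h p) (w1 h p) <= eps h ^+ 2 /\
    dot (w2 h p) (w2 h p) <= eps h ^+ 2.
  by near: h; exact: dot_shift_le.
apply: filterS Lb_le => p /(_ h) Lp.
rewrite gee0_abs ?lee_fin ?scaled_integrand_ge0// /dominating_fun.
rewrite /scaled_integrand rot_scale_shift.
(* the parallelogram identity gives |a|^2 <= 2 |a + v|^2 + 2 |v|^2, where
   |a|^2 = 2 |p.2|^2 and |v|^2 <= 4 *)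
set t := T h _; set a := (2 * s) *: p.2; set v := w1 h p - w2 h p.
have expo : expR (- (b0 * dot (a + v) (a + v))) <=
    expR (4 * b0) * expR (- (b0 * dot p.2 p.2)).
  rewrite -expRD ler_expR -subr_ge0.
  rewrite (_ : _ - _ = b0 * (4 + dot (a + v) (a + v) - dot p.2 p.2)); last by ring.
  apply: mulr_ge0; first exact: ltW.
  have [d1 d2] := dle p.
  have vle : dot v v <= 4.
    apply: (@le_trans _ _ (2 * dot (w1 h p) (w1 h p) + 2 * dot (w2 h p) (w2 h p))).
      by rewrite -dotvv_parallelogram lerDr dotvv_ge0.
    lra.
  have := dotvv_parallelogram dot (a + v) v; rewrite addrK.
  have -> : dot a a = 2 * dot p.2 p.2.
    by rewrite dotvvZ exprMn sqr_invsqrt2; field.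
  have := dotvv_ge0 dot (a + v + v).
  lra.
apply: (@le_trans _ _ (Lb (rot_scale (lam h) p) *
    (M * (expR (4 * b0) * expR (- (b0 * dot p.2 p.2)))))%:E).
  rewrite lee_fin; apply: ler_wpM2l => //; apply: ler_pM => //; exact: expR_ge0.
rewrite muleCA -EFinM [X in (_ <= _ * X)%E](_ : _ =
    (M * (expR (4 * b0) * expR (- (b0 * dot p.2 p.2))))%:E); last by rewrite mulrA.
rewrite EFinM; apply: lee_wpmul2r.
  by rewrite lee_fin !mulr_ge0// expR_ge0.
by apply: le_trans Lp _; exact: lee_abs.
Unshelve. all: by end_near. Qed.

Lemma integral_scaled_integrand_cvg :
  (\int[leb \x leb]_p (scaled_integrand h p)%:E)%E @[h --> \oo] -->
  (\int[leb \x leb]_p (limit_integrand p)%:E)%E.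
Proof.
(* The domination holds only from [h0] on, so dominated convergence is applied to the shifted
   sequence. *)
have [h0 _ dom] := scaled_integrand_dominated.
rewrite -(cvg_shiftn h0).
pose u h p := (scaled_integrand (h + h0) p)%:E.
have mu h : measurable_fun setT (u h).
  by apply/measurable_EFinP; exact: measurable_scaled_integrand.
have ml : measurable_fun setT (fun p => (limit_integrand p)%:E).
  by apply/measurable_EFinP; exact: measurable_limit_integrand.
have ul : {ae (leb \x leb)%E, forall p, setT p ->
    u h p @[h --> \oo] --> (limit_integrand p)%:E}.
  apply: filterS scaled_integrand_cvg => p pl _; apply: cvg_EFin; first exact: nearW.
  rewrite -(cvg_shiftn h0) in pl; exact: pl.
have ud : {ae (leb \x leb)%E, forall p h, setT p -> (`|u h p| <= dominating_fun p)%E}.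
  suff : {ae (leb \x leb)%E, forall p h, (`|u h p| <= dominating_fun p)%E}.
    by apply: filterS => p up h _; exact: up.
  by apply: ae_foralln => h; apply: dom; rewrite /= leq_addl.
by have [] := dominated_convergence measurableT mu ml ul integrable_dominating_fun ud.
Qed.

(** The limit separates: the Gaussian in [eta] splits off as a factor independent of [f], and
    rescaling xi by [s] leaves the integral along the diagonal against [Lh]. *)
Lemma integral_limit_integrand :
  (\int[leb \x leb]_p (limit_integrand p)%:E =
   (`|s|^-1 ^+ n)%:E * \int[leb]_u (f (u, u) * Lh u)%:E *
   \int[leb]_u (expR (- (2 * b0 * dot u u)))%:E)%E.
Proof.
have mF : measurable_fun setT (fun u : Z => (f (u, u) * Lh u)%:E).
  apply/measurable_EFinP; apply: measurable_funM => //.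
  apply: (measurableT_comp (measurable_continuous_rVX cf)).
  by apply: measurable_fun_pair; exact: measurable_id.
have F0 (u : Z) : (0 <= (f (u, u) * Lh u)%:E)%E by rewrite lee_fin mulr_ge0.
have s0 : s != 0 by rewrite invr_neq0// gt_eqF// sqrtr_gt0.
have := ge0_integral_leb_affine 0 s0 mF F0 => <-.
have mscale : measurable_fun setT (fun u : Z => s *: u + 0).
  apply: measurable_rVD; last exact: measurable_cst.
  by apply: measurable_rVZ; exact: measurable_id.
have mFs := measurableT_comp mF mscale.
have mE : measurable_fun setT (fun u : Z => (expR (- (2 * b0 * dot u u)))%:E).
  by apply/measurable_EFinP; exact: measurable_gauss.
have E0 (u : Z) : (0 <= (expR (- (2 * b0 * dot u u)))%:E)%E by rewrite lee_fin expR_ge0.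
have := ge0_integral_prod_fun (@leb R n) (@leb R n) mFs mE (fun=> F0 _) E0.
move=> <-; apply: eq_integral => p _.
by rewrite /= addr0 -EFinM.
Qed.

End thermalized_limit.

(** * Rescaled expectations *)

Lemma integral_cst1 d (T : measurableType d) (R : realType)
    (mu : {measure set T -> \bar R}) :
  (\int[mu]_x (cst (1 : R)%R x)%:E = mu setT)%E.
Proof. by rewrite -[RHS]mul1e -(integral_cst mu measurableT 1). Qed.

Section mean.
Context d (T : measurableType d) (R : realType) (mu : {measure set T -> \bar R}).
Context (mu_fin : (0 < mu setT < +oo)%E).

Lemma fin_num_mu_setT : mu setT \is a fin_num.
Proof. by move: mu_fin => /andP[? ?]; rewrite ge0_fin_numE. Qed.

Lemma integrable_bounded (f : T -> R) (M : R) : measurable_fun setT f ->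
  (forall x, `|f x| <= M) -> mu.-integrable setT (EFin \o f).
Proof.
move=> mf fM.
apply: (@le_integrable _ _ _ mu _ measurableT _ (EFin \o cst M)).
- exact/measurable_EFinP.
- by move=> x _ /=; rewrite lee_fin (le_trans (fM x)) ?ler_norm.
apply/integrableP; split; first by apply/measurable_EFinP; exact: measurable_cst.
rewrite /= (eq_integral (cst (`|M|)%:E))// integral_cst//=.
by move: mu_fin => /andP[_ ?]; apply: lte_mul_pinfty.
Qed.

(** Reduces bounded functions to nonnegative ones. *)
Lemma mean_addr (f : T -> R) (M : R) : measurable_fun setT f ->
  (forall x, `|f x| <= M) -> mean mu (fun x => f x + M) = mean mu f + M.
Proof.
move=> mf fM; rewrite /mean RintegralD//; last 2 first.
- exact: integrable_bounded mf fM.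
- by apply: (@integrable_bounded _ `|M|) => //; exact: measurable_cst.
rewrite Rintegral_cst// mulrDl -mulrA divff ?mulr1//.
by rewrite gt_eqF// fine_gt0.
Qed.

End mean.

Lemma bounded_funP (T : Type) (R : realType) (f : T -> R) :
  bounded_fun f -> exists M, forall x, `|f x| <= M.
Proof.
move=> [M [_ fM]]; exists (M + 1) => x.
by apply: fM => //; rewrite ltrDl.
Qed.

(** * Sample points and the rescaled form of the discrete integrals *)

Section assembly.
Context {R : realType} {n : nat} (dot : {dot 'rV[R]_n for idfun}).
Local Notation Z := 'rV[R]_n.
Context (A : nat -> nat -> set (Z * Z)) (A_meas : forall h i, measurable (A h i)).
Context (A_part : forall h, partition setT (A h) setT).
Context (yz : nat -> nat -> Z * Z) (yz_A : forall h i, A h i (yz h i)).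

Definition sample h p := yz h (pblock_index setT (A h) p).

Lemma measurable_sample h : measurable_fun setT (sample h).
Proof. exact: measurable_fun_step. Qed.

Lemma ddist_sample h p :
  ((ddist dot p (sample h p))%:E <=
   ereal_sup [set diam dot (pblock setT (A h) q) | q in setT])%E.
Proof.
apply: (@le_trans _ _ (diam dot (pblock setT (A h) p))); last first.
  by apply: ereal_sup_ubound; exists p.
apply: ereal_sup_ubound; exists p; first exact: pblock_indexP.
by exists (sample h p) => //; exact: yz_A.
Qed.

(** A point and its sample lie in one cell. The bound is only eventual because [fine] sends an
    infinite product to 0, and the products are finite only for large h. *)
Lemma sample_close (lam : nat -> R) : (forall h, 0 < lam h) ->
  ((lam h)%:E * ereal_sup [set diam dot (pblock setT (A h) p) | p in setT])%E
    @[h --> \oo] --> 0%E ->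
  exists2 eps : nat -> R, eps h @[h --> \oo] --> 0 &
    \forall h \near \oo, forall p,
      lam h ^+ 2 * (dot (p.1 - (sample h p).1) (p.1 - (sample h p).1) +
                    dot (p.2 - (sample h p).2) (p.2 - (sample h p).2)) <=
      eps h ^+ 2.
Proof.
move=> lam0; pose D h := ereal_sup [set diam dot (pblock setT (A h) p) | p in setT].
move=> /fine_cvgP[ufin ucvg].
exists (fun h => fine ((lam h)%:E * D h)%E) => //.
apply: filterS ufin => h ufin p.
(* As [lam h] is positive, an infinite [D h] would make the product infinite. *)
have Dfin : D h \is a fin_num.
  move: ufin; rewrite -/(D h); case: (D h) => [//| |].
    by rewrite gt0_muley ?lte_fin.
  by rewrite gt0_muleNy ?lte_fin.
have := ddist_sample h p; rewrite -/(D h) -(fineK Dfin) lee_fin => dD.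
rewrite -EFinM /=.
have d0 : 0 <= ddist dot p (sample h p) by exact: sqrtr_ge0.
rewrite -!sqr_dnorm (_ : _ + _ = ddist dot p (sample h p) ^+ 2); last first.
  by rewrite [RHS]sqr_sqrtr// addr_ge0// exprn_ge0// sqrtr_ge0.
have l0 : 0 <= lam h by exact: ltW.
have ld : lam h * ddist dot p (sample h p) <= lam h * fine (D h).
  by rewrite ler_wpM2l.
have ld0 : 0 <= lam h * ddist dot p (sample h p) by rewrite mulr_ge0.
by rewrite -exprMn lerXn2r// nnegrE// (le_trans ld0).
Qed.

Context (L Lb : Z * Z -> R) (mLb : measurable_fun setT Lb).
Context (Lb0 : forall p, 0 <= Lb p) (LLb : {ae (leb \x leb)%E, forall p, L p = Lb p}).
Context (c : nat -> nat -> {nonneg R}).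
Context (cE : forall h i,
      ((c h i)%:num%:E = \int[leb \x leb]_(p in A h i) (L p)%:E)%E).
Context (lam : nat -> R) (lam_gt0 : forall h, 0 < lam h) (b0 : R).

(** The discrete sum becomes an integral of a step function times [Lb], to which [rot_scale] is
    applied; the prefactor does not depend on [f]. *)
Lemma integral_thermalized_rescaled h (f : Z * Z -> R) :
  continuous f -> (forall p, 0 <= f p) ->
  (\int[thermalized dot (b0 * lam h ^+ 2) (atomic (c h) (yz h))]_p (f p)%:E =
   ((gauss_mass dot (b0 * lam h ^+ 2))^-1 * (lam h ^+ n)^-1)%:E *
   \int[leb \x leb]_p (scaled_integrand dot Lb lam b0 sample f h p)%:E)%E.
Proof.
move=> cf f0; set b := b0 * lam h ^+ 2; have mf := measurable_continuous_rVX cf.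
rewrite ge0_integral_thermalized_atomic//.
pose a i := f (yz h i) * weight dot b (yz h i).
have a0 i : 0 <= a i by rewrite mulr_ge0// weight_ge0.
have cLb i : ((c h i)%:num%:E = \int[leb \x leb]_(p in A h i) (Lb p)%:E)%E.
  (* The coefficients are integrals of [L], which need not be Borel; they are not changed by passing
     to [Lb]. *)
  rewrite cE; apply: eq_integral_ae; apply: filterS LLb => p -> //.
transitivity (\sum_(0 <= i <oo) (a i * (c h i)%:num)%:E)%E.
  by apply: eq_eseriesr => i _; rewrite /a mulrAC.
rewrite (ge0_integral_step (A_part h) (A_meas h) mLb Lb0 a0 cLb).
pose F p := Lb p * (f (sample h p) *
  expR (- (b * dot ((sample h p).1 - (sample h p).2) ((sample h p).1 - (sample h p).2)))).
have mF : measurable_fun setT F.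
  apply: measurable_funM => //; apply: measurable_funM.
    exact: (measurableT_comp mf (measurable_sample h)).
  apply: (measurableT_comp (measurable_gauss dot b)).
  under eq_fun do rewrite -scaleN1r.
  apply: measurable_rVD; last apply: measurable_rVZ.
    exact: (measurableT_comp measurable_fst (measurable_sample h)).
  exact: (measurableT_comp measurable_snd (measurable_sample h)).
have mFE : measurable_fun setT (fun p => (F p)%:E) by exact/measurable_EFinP.
have F0 p : (0 <= (F p)%:E)%E by rewrite lee_fin !mulr_ge0// expR_ge0.
have B0 : 0 <= (gauss_mass dot b)^-1.
  by rewrite invr_ge0; apply: Rintegral_ge0 => // x _; exact: expR_ge0.
transitivity ((gauss_mass dot b)^-1%:E * \int[leb \x leb]_p (F p)%:E)%E.
  rewrite -ge0_integralZl//.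
  apply: eq_integral => p _; rewrite -EFinM; congr EFin.
  by rewrite /F /a -/(sample h p) /weight sqr_dnorm; ring.
rewrite EFinM -muleA; congr (_ * _)%E.
have l0 : lam h ^+ n != 0 by rewrite expf_neq0// gt_eqF.
have := ge0_integral_rot_scale (lam_gt0 h) mFE F0.
rewrite [X in (X = _)%E -> _](_ : _ = \int[leb \x leb]_p
    (scaled_integrand dot Lb lam b0 sample f h p)%:E)%E.
  by move=> ->; rewrite muleA -EFinM mulVf// mul1e.
apply: eq_integral => p _; rewrite /F /scaled_integrand dotvvZ /b.
by rewrite -[b0 * _ * _]mulrA.
Qed.

End assembly.

Theorem mainTheorem5 (R : realType) (N : nat) (N_gt0 : (0 < N)%N)
    (dot : {dot phase_space R N for idfun})
    (L : phase_space R N * phase_space R N -> R)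
    (L_loc : in_L1loc L) (L_ge0 : forall p, 0 <= L p)
    (* (a) *)
    (Lhat : phase_space R N -> R)
    (L_lim : {ae (leb \x leb)%E, forall p : phase_space R N * phase_space R N,
      L (rot_scale lambda p) @[lambda --> +oo] -->
        Lhat ((Num.sqrt 2)^-1 *: p.1)})
    (* (b) *)
    (g0 : phase_space R N * phase_space R N -> R) (lambda0 beta0 : R)
    (g0_L1 : in_L1 (leb \x leb)%E setT (EFin \o g0))
    (lambda0_gt0 : 0 < lambda0) (beta0_gt0 : 0 < beta0)
    (L_dom : {ae (leb \x leb)%E, forall p : phase_space R N * phase_space R N,
      forall lambda, lambda0 <= lambda ->
        weight_bar dot beta0 p.2 * L (rot_scale lambda p) <= g0 p})
    (* (c) *)
    (ghat_L1 : in_L1 leb setT (fun xi : phase_space R N =>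
      ereal_sup [set (L ((Num.sqrt 2)^-1 *: (xi + eta),
                         (Num.sqrt 2)^-1 *: (xi - eta)))%:E | eta in setT]))
    (* (d) *)
    (mu_oo : {measure set (phase_space R N * phase_space R N) -> \bar R})
    (mu_ooE : forall f : phase_space R N * phase_space R N -> R, Cb f ->
      (\int[mu_oo]_p (f p)%:E =
       \int[leb]_(xi in setT) (f (xi, xi) * Lhat xi)%:E)%E)
    (mu_oo_fin : (0 < mu_oo setT < +oo)%E)
    (* discretization *)
    (A : nat -> nat -> set (phase_space R N * phase_space R N))
    (A_meas : forall h i, measurable (A h i))
    (A_part : forall h, partition setT (A h) setT)
    (yz : nat -> nat -> phase_space R N * phase_space R N)
    (yz_A : forall h i, A h i (yz h i))
    (c : nat -> nat -> {nonneg R})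
    (cE : forall h i,
      ((c h i)%:num%:E = \int[leb \x leb]_(p in A h i) (L p)%:E)%E)
    (beta : nat -> R) (beta_gt0 : forall h, 0 < beta h)
    (beta_oo : beta h @[h --> \oo] --> +oo)
    (diam_lim : ((Num.sqrt (beta h / beta0))%:E *
       ereal_sup [set diam dot (pblock setT (A h) p) | p in setT])%E
       @[h --> \oo] --> 0%E) :
  let mu_beta h : {measure set (phase_space R N * phase_space R N) -> \bar R} :=
    thermalized dot (beta h) (atomic (c h) (yz h)) in
  (\forall h \near \oo, (0 < mu_beta h setT < +oo)%E) /\
  forall f : phase_space R N * phase_space R N -> R, Cb f ->
    (\forall h \near \oo, mean (mu_beta h) f =
       fine (\sum_(0 <= i <oo) (f (yz h i) * (c h i)%:num *
               weight dot (beta h) (yz h i))%:E) /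
       fine (\sum_(0 <= i <oo) ((c h i)%:num *
               weight dot (beta h) (yz h i))%:E)) /\
    mean (mu_beta h) f @[h --> \oo] --> mean mu_oo f.
Proof.
move=> mu_beta.
pose s : R := (Num.sqrt 2)^-1.
have s_neq0 : s != 0 by rewrite invr_neq0// gt_eqF// sqrtr_gt0.
have [Lb [mLb Lb0 LLb]] := in_L1loc_borel L_loc L_ge0.
have [Lh [mLh Lh0 LhE]] := diagonal_limit_borel mLb Lb0 LLb L_lim.
pose lam h := Num.sqrt (beta h / beta0).
have lam_gt0 h : 0 < lam h by rewrite sqrtr_gt0 divr_gt0.
have betaE h : beta h = beta0 * lam h ^+ 2.
  by rewrite sqr_sqrtr ?divr_ge0 ?ltW// mulrC divfK// gt_eqF.
have lam_oo : lam h @[h --> \oo] --> +oo.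
  apply/cvgryPge => a; have /cvgryPge/(_ (beta0 * a ^+ 2)) := beta_oo.
  apply: filterS => h; rewrite betaE ler_pM2l// => a2.
  apply: (le_trans (ler_norm a)).
  by rewrite -(ger0_norm (ltW (lam_gt0 h))) -ler_sqr ?nnegrE// !real_normK ?num_real.
have LLbS : {ae (leb \x leb)%E, forall p h,
    L (rot_scale (lam h) p) = Lb (rot_scale (lam h) p)}.
  apply: ae_foralln => h.
  apply: (ae_pushforward (P := fun p => L p = Lb p) (measurable_rot_scale _) _ LLb).
  by move=> X; exact: null_preimage_rot_scale.
have Lh_scale : {ae leb, forall u : phase_space R N, Lhat (s *: u) = Lh (s *: u)}.
  have ms : measurable_fun setT (fun u : phase_space R N => s *: u).
    by apply: measurable_rVZ; exact: measurable_id.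
  have := ae_pushforward ms _ LhE.
  by move=> /(_ leb (fun X => @null_preimage_scale R _ s X s_neq0)).
have Lb_cvg : {ae (leb \x leb)%E, forall p : phase_space R N * phase_space R N,
    Lb (rot_scale (lam h) p) @[h --> \oo] --> Lh (s *: p.1)}.
  have Lh_fst : {ae (leb \x leb)%E, forall p : phase_space R N * phase_space R N,
    Lhat (s *: p.1) = Lh (s *: p.1)} := ae_prod_fst leb Lh_scale.
  apply: filterS3 LLbS L_lim Lh_fst => p LLp /cvg_pinftyP/(_ _ lam_oo) Lp <-.
  by under eq_fun do rewrite -LLp.
have [g ig ghatE] := ghat_L1.
have Lb_le : {ae (leb \x leb)%E, forall p : phase_space R N * phase_space R N,
    forall h, ((Lb (rot_scale (lam h) p))%:E <= g p.1)%E}.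
  have gfst : {ae (leb \x leb)%E, forall p : phase_space R N * phase_space R N,
    setT p.1 -> _ = g p.1} := ae_prod_fst leb ghatE.
  apply: filterS2 LLbS gfst => p LLp /(_ I) <- h; rewrite -LLp.
  (* Taking eta / lambda as the competitor in the supremum of (c) gives exactly the rotated point,
     whence a bound independent of h. *)
  by apply: ereal_sup_ubound; exists ((lam h)^-1 *: p.2).
have [eps eps_cvg T_close] := sample_close A_part yz_A lam_gt0 diam_lim.
pose J (f : phase_space R N * phase_space R N -> R) h := (\int[leb \x leb]_p
  (scaled_integrand dot Lb lam beta0 (sample A yz) f h p)%:E)%E.
pose E : \bar R := (\int[leb]_(u in @setT (phase_space R N))
  (expR (- (2 * beta0 * dot u u)))%:E)%E.
have b20 : 0 < 2 * beta0 by rewrite mulr_gt0.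
have Efin : E \is a fin_num.
  by rewrite ge0_fin_numE ?integral_gauss_lty// ltW// integral_gauss_gt0.
(* Everything in the limit that does not depend on [f]: the Jacobian of the scaling by [s] and the
   Gaussian integral. It cancels in the quotient. *)
pose C := `|s|^-1 ^+ (2 * N) * fine E.
have C0 : 0 < C.
  rewrite mulr_gt0// ?exprn_gt0 ?invr_gt0 ?normr_gt0// fine_gt0//.
  by rewrite integral_gauss_gt0 integral_gauss_lty.
pose I (f : phase_space R N * phase_space R N -> R) := (\int[mu_oo]_p (f p)%:E)%E.
have J_cvg (f : phase_space R N * phase_space R N -> R) M :
    continuous f -> (forall p, 0 <= f p) -> (forall p, f p <= M) ->
    J f h @[h --> \oo] --> (C%:E * I f)%E.
  move=> cf f0 fM.
  have := integral_scaled_integrand_cvg mLb Lb0 mLh lam_gt0 lam_oo beta0_gt0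
    Lb_cvg ig Lb_le (measurable_sample A_meas A_part yz) eps_cvg T_close cf f0 fM.
  rewrite (integral_limit_integrand dot mLh Lh0 beta0 cf f0).
  suff -> : (C%:E * I f = (`|s|^-1 ^+ (2 * N))%:E *
    (\int[leb]_u (f (u, u) * Lh u)%:E) * E)%E by [].
  rewrite /C EFinM fineK// -muleA [(E * _)%E]muleC muleA; congr (_ * _ * _)%E.
  rewrite /I mu_ooE; last first.
    split => //; exists M; split; first exact: num_real.
    by move=> x Mx p _; rewrite /= ger0_norm// (le_trans (fM p))// ltW.
  by apply: eq_integral_ae; apply: filterS LhE => u -> _.
(* This positive factor is common to numerator and denominator, so its behaviour as h grows is
   irrelevant. *)
pose k h := (gauss_mass dot (beta h))^-1 * (lam h ^+ (2 * N))^-1.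
have k0 h : 0 < k h.
  by rewrite mulr_gt0// invr_gt0 ?gauss_mass_gt0// exprn_gt0.
have muJ (f : phase_space R N * phase_space R N -> R) h :
    continuous f -> (forall p, 0 <= f p) ->
    (\int[mu_beta h]_p (f p)%:E = (k h)%:E * J f h)%E.
  move=> cf f0; rewrite /mu_beta /k betaE.
  exact: (integral_thermalized_rescaled dot A_meas A_part yz mLb Lb0 LLb cE lam_gt0
    beta0 h cf f0).
have mu_setT h : mu_beta h setT = ((k h)%:E * J (cst 1%R) h)%E.
  rewrite -muJ//; last exact: cst_continuous.
  by rewrite integral_cst1.
have Ioo : I (cst 1%R) = mu_oo setT by rewrite /I integral_cst1.
have mu_oo_num := fin_num_mu_setT mu_oo_fin.
have J1_cvg : J (cst 1%R) h @[h --> \oo] --> (C * fine (mu_oo setT))%:E.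
  rewrite EFinM fineK// -Ioo; apply: (J_cvg _ 1) => //.
  exact: cst_continuous.
have m0 : 0 < fine (mu_oo setT) by exact: fine_gt0.
(* The rescaled masses converge to a positive real number, so they are eventually finite and
   positive; this is the sense in which the expectations are defined for large h. *)
have mu_fin : \forall h \near \oo, (0 < mu_beta h setT < +oo)%E.
  have /fine_cvgP[J1fin J1f] := J1_cvg.
  have Cm0 : 0 < C * fine (mu_oo setT) by rewrite mulr_gt0.
  have J1pos : \forall h \near \oo, 0 < fine (J (cst 1%R) h).
    exact: (cvgr_gt _ J1f _ Cm0).
  apply: filterS2 J1fin J1pos => h J1h J1p; rewrite mu_setT -(fineK J1h) -EFinM.
  by rewrite lte_fin ltry andbT mulr_gt0.
have mean_cvg0 (f : phase_space R N * phase_space R N -> R) M :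
    continuous f -> (forall p, 0 <= f p) -> (forall p, f p <= M) ->
    mean (mu_beta h) f @[h --> \oo] --> mean mu_oo f.
  move=> cf f0 fM; have mf := measurable_continuous_rVX cf.
  have Ifin : I f \is a fin_num.
    apply: integrable_fin_num => //; apply: (integrable_bounded mu_oo_fin mf (M := M)).
    by move=> p; rewrite ger0_norm.
  have Jf_cvg : J f h @[h --> \oo] --> (C * fine (I f))%:E.
    by rewrite EFinM fineK//; exact: J_cvg fM.
  have -> : mean mu_oo f = (C * fine (I f)) / (C * fine (mu_oo setT)).
    by rewrite -mulf_div divff ?gt_eqF// mul1r.
  have /fine_cvgP[Jfin Jc] := Jf_cvg; have /fine_cvgP[J1fin J1c] := J1_cvg.
  apply: (cvg_trans _ (cvgM Jc (cvgV _ J1c))); last by rewrite gt_eqF// mulr_gt0.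
  apply: near_eq_cvg; apply: filterS2 Jfin J1fin => h Jh J1h /=.
  rewrite /mean /Rintegral muJ// mu_setT -(fineK Jh) -(fineK J1h) -!EFinM /=.
  by rewrite -mulf_div divff ?mul1r// gt_eqF.
split => // f [cf /bounded_funP[M fM]]; have mf := measurable_continuous_rVX cf.
split.
  apply: filterS mu_fin => h /andP[_ mu_lty].
  rewrite /mean /Rintegral (integral_thermalized_atomic mu_lty mf fM).
  congr (_ / fine _).
  rewrite -[LHS](integral_cst1 (mu_beta h)) ge0_integral_thermalized_atomic//.
  by apply: eq_eseriesr => i _; rewrite mul1r.
(* Adding the bound [M] of |f| makes the function nonnegative; both means then shift by exactly
   [M]. *)
have fM0 p : 0 <= f p + M.
  by rewrite -lerBlDr sub0r lerNl (le_trans _ (fM p))// -normrN ler_norm.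
have fM2 p : f p + M <= M + M by rewrite lerD2r (le_trans _ (fM p))// ler_norm.
have cfM : continuous (fun p => f p + M).
  by move=> p; apply: cvgD; [exact: cf|exact: cvg_cst].
have := mean_cvg0 _ _ cfM fM0 fM2; rewrite (mean_addr mu_oo_fin mf fM).
move=> meanM_cvg; rewrite -(addrK M (mean mu_oo f)).
apply: (cvg_trans _ (cvgB meanM_cvg (cvg_cst M))).
apply: near_eq_cvg; apply: filterS mu_fin => h hfin.
by rewrite fctE (mean_addr hfin mf fM) addrK.
Qed.
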